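(* Let $d\ge 1$ be an integer, $k=d+1$, and $\boldsymbol\alpha\in\mathbb R^d$. Let $\phi:[1,\infty)\to[1,\infty)$ be non-decreasing (and such that the function $L$ below is well defined) and suppose that $$\|\mathbf m\cdot\boldsymbol\alpha\|>\frac1{H(\mathbf m)\,\phi(H(\mathbf m))}\qquad(\mathbf 0\ne\mathbf m\in\mathbb Z^d)$$ and $$\xi:=\limsup_{x\to\infty}\frac{\phi(2x)}{\phi(x)}<\infty .$$ Let $\boldsymbol\omega\in\mathcal G_{k,\ell}$, where $\ell$ is an integer with $$\ell>2+2\,\frac{\log\xi}{\log 2}.$$ Then there is a constant $C$, not depending on $N$, such that for every positive integer $N\ge\phi(1)$, $$D_{\boldsymbol\omega}(\boldsymbol\alpha;N)\le C\,\phi(L(N)).$$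
   Context: Notation. $\|x\|=\min_{a\in\mathbb Z}|x-a|$ for $x\in\mathbb R$. For $\mathbf m\in\mathbb R^d$, $H(\mathbf m)=\prod_{i\le d}\max\{1,|m_i|\}$. $e(z)=e^{2\pi i z}$ and $\widehat f(\xi)=\int_{\mathbb R}f(x)e(-\xi x)\,dx$. The function $L$. For $x\ge\phi(1)$, $L(x)\in[1,x]$ denotes the value of $H$ such that $H\phi(H)=x$. (It is unique because $H\mapsto H\phi(H)$ is strictly increasing; it is assumed that it exists for every $x\ge\phi(1)$, which is the case exactly when $\phi$ is continuous.) The class $\mathcal G_{k,\ell}$. It is the set of $\boldsymbol\omega=(\omega_1,\ldots,\omega_k)$ such that for each $i\le k$: $\omega_i:\mathbb R\to[0,\infty)$ is $\ell$ times continuously differentiable, $\mathrm{supp}(\omega_i)\subseteq[-2,2]$, $\widehat\omega_i\ge0$ everywhere, and $\widehat\omega_i(0)>0$. Smooth discrepancy. Put $\mathfrak C(\boldsymbol\omega)=\widehat\omega_1(0)\cdots\widehat\omega_k(0)$. A box is a pair $\mathfrak B=(\boldsymbol\gamma;\boldsymbol\rho)$ with $\boldsymbol\gamma\in\mathbb R^d$, $\boldsymbol\rho\in(0,1/2)^d$, and $\mathrm{vol}(\mathfrak B;N)=\rho_1\cdots\rho_dN$. Define $$D_{\boldsymbol\omega}(\mathfrak B;N)=\sum_{\mathbf a\in\mathbb Z^k}\omega_k\Big(\frac{a_k}{N}\Big)\prod_{i\le d}\omega_i\Big(\frac{a_i+a_k\alpha_i-\gamma_i}{\rho_i}\Big)-\mathfrak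 C(\boldsymbol\omega)\,\mathrm{vol}(\mathfrak B;N)$$ and $D_{\boldsymbol\omega}(\boldsymbol\alpha;N)=\sup_{\mathfrak B}|D_{\boldsymbol\omega}(\mathfrak B;N)|$, the supremum being over all boxes $\mathfrak B=(\boldsymbol\gamma;\boldsymbol\rho)$ with $\boldsymbol\gamma\in\mathbb R^d$ and $\boldsymbol\rho\in(0,1/2)^d$. *)

(* Defs.v *)
From HB Require Import structures.
From mathcomp Require Import all_boot all_order all_algebra.
From mathcomp Require Import all_classical all_reals all_analysis.
From mathcomp.real_closed Require Export complex.

Set Implicit Arguments.
Unset Strict Implicit.
Unset Printing Implicit Defensive.

Import Order.TTheory GRing.Theory Num.Theory.
Import numFieldNormedType.Exports.

Local Open Scope classical_set_scope.
Local Open Scope ring_scope.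
Local Open Scope complex_scope.

Section Arithmetic.
Variable R : realType.

(* The set below is nonempty, bounded below and has a least element, so its
   infimum is a minimum. *)
Definition dist_int (x : R) : R := inf (range (fun a : int => `|x - a%:~R|)).

Definition intv d (m : 'rV[int]_d) : 'rV[R]_d := \row_(i < d) (m 0 i)%:~R.

Definition dotv d (u v : 'rV[R]_d) : R := \sum_(i < d) u 0 i * v 0 i.

Definition height d (m : 'rV[R]_d) : R := \prod_(i < d) Num.max 1 `|m 0 i|.

(* As H |-> H * phi H is strictly increasing on [1, +oo[ when phi is positive
   and nondecreasing there, this property determines L on [phi 1, +oo[. *)
Definition is_L (phi L : R -> R) : Prop :=
  forall x : R, phi 1 <= x -> 1 <= L x <= x /\ L x * phi (L x) = x.

End Arithmetic.

Arguments intv R {d} m.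

Section Fourier.
Variable R : realType.

Definition echar (z : R) : R[i] := cos (2 * pi * z) +i* sin (2 * pi * z).

Definition cintegral (g : R -> R[i]) : R[i] :=
  Rintegral lebesgue_measure setT (fun x => complex.Re (g x)) +i*
  Rintegral lebesgue_measure setT (fun x => complex.Im (g x)).

Definition fourier (f : R -> R) (xi : R) : R[i] :=
  cintegral (fun x => (f x)%:C * echar (- xi * x)).

Definition contdiff (l : nat) (f : R -> R) : Prop :=
  (forall (j : nat) (x : R), (j < l)%N -> derivable (f^`(j))%classic x 1) /\ continuous (f^`(l))%classic.

(* In the order of R[i], 0 <= z means that z is real and nonnegative. *)
Definition classG (k l : nat) (omega : 'I_k -> R -> R) : Prop :=
  forall i : 'I_k,
    [/\ forall x, 0 <= omega i x,
        contdiff l (omega i),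
        closure [set x | omega i x != 0] `<=` `[- 2, 2],
        forall xi, 0 <= fourier (omega i) xi &
        0 < fourier (omega i) 0].

End Fourier.

(* Throughout, k = d + 1: the index k is ord_max : 'I_d.+1, and i <= d is
   embedded in 'I_d.+1 by widen_ord. *)
Section Discrepancy.
Variables (R : realType) (d : nat).

Definition first_d (i : 'I_d) : 'I_d.+1 := widen_ord (leqnSn d) i.

(* For omega in classG the product is real, so that taking its real part loses
   nothing. *)
Definition Cconst (omega : 'I_d.+1 -> R -> R) : R :=
  complex.Re (\prod_(i < d.+1) fourier (omega i) 0).

(* A box is a pair (gamma, rho). *)
Definition boxes : set ('rV[R]_d * 'rV[R]_d) :=
  [set B : 'rV[R]_d * 'rV[R]_d | forall i : 'I_d, 0 < B.2 0 i < 1 / 2].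

Definition vol (B : 'rV[R]_d * 'rV[R]_d) (N : nat) : R :=
  (\prod_(i < d) B.2 0 i) * N%:R.

Definition weight (omega : 'I_d.+1 -> R -> R) (alpha : 'rV[R]_d)
    (B : 'rV[R]_d * 'rV[R]_d) (N : nat) (a : 'rV[int]_d.+1) : R :=
  omega ord_max ((a 0 ord_max)%:~R / N%:R) *
  \prod_(i < d) omega (first_d i)
    (((a 0 (first_d i))%:~R + (a 0 ord_max)%:~R * alpha 0 i - B.1 0 i)
     / B.2 0 i).

(* esum is the sum of a family of nonnegative terms, which these are for omega
   in classG. *)
Definition discrB (omega : 'I_d.+1 -> R -> R) (alpha : 'rV[R]_d)
    (B : 'rV[R]_d * 'rV[R]_d) (N : nat) : \bar R :=
  (\esum_(a in [set: 'rV[int]_d.+1]) (weight omega alpha B N a)%:E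
   - (Cconst omega * vol B N)%:E)%E.

Definition discr (omega : 'I_d.+1 -> R -> R) (alpha : 'rV[R]_d) (N : nat)
    : \bar R :=
  ereal_sup [set `|discrB omega alpha B N|%E | B in boxes].

End Discrepancy.

(* Main.v *)
Require Import Defs.
From mathcomp Require Import all_boot all_order all_algebra.
From mathcomp Require Import all_classical all_reals all_analysis.
From mathcomp Require Import ring lra zify.

(** The idea is to trade the count of lattice points for a sum over frequencies,
and to control that sum by the separation of the numbers [m . alpha] modulo 1.

Fix a box with sides [rho i], put [P = \prod_i rho i], and let [H0 = L N], so
that [H0 * phi H0 = N].  By Poisson summation the weighted count equals
[P * N] times a sum over integer frequencies, whose zero term is the main term,
and in which the weight of the frequency [m] is bounded, up to a constant, by the
product of the [min (1, (rho i * |m i|) ^ (- l))] and of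
[(1 + N * ||m . alpha||) ^ (- 2)], [||x||] being the distance to the integers.
Frequencies in a box of volume [H] have differences of height [O(H)], so by the
Diophantine hypothesis the numbers [m . alpha] are separated modulo 1 by about
[1 / (H * phi H)], and the sum of [N / (1 + N * ||m . alpha||) ^ 2] over the
nonzero [m] of that box is [O(H * phi H)] ([separated_sum], [box_sum]). The
decay in [rho i * m i] is a superposition of indicators of the boxes [|m i| <= 2
^ j i / rho i], of weight [2 ^ (- l * \sum_i j i)] and volume [2 ^ (\sum_i j i)
/ P] ([dyadic_decay]).
If [P >= 1 / H0], the box of index [j] contributes
[2 ^ (- (l - 1) * \sum_i j i) * phi (2 ^ (\sum_i j i) * H0)] up to a constant.
The hypothesis on [l] makes [phi] eventually grow by a factor less than
[2 ^ (l - 1)] at each doubling, so the sum over [j] is [O(phi H0)] ([error_sum],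
[count_sum_asymptotic]).

If [P < 1 / H0], the count is dominated by the count of a larger box, of volume
about [1 / H0], to which the previous case applies.  Both volumes times [N] are
[O(N / H0) = O(phi H0)], hence so is the discrepancy ([count_sum_uniform]).

Poisson summation is only used approximately, and by finite means.  In the
variables [a i] with [i <= d], each periodised weight is approximated by the
trigonometric polynomial of a discrete Fourier transform on a fine grid
([periodization_approx]), whose mesh tends to 0 at the end.  In the last
variable, and for the size of the discrete Fourier coefficients, the decay comes
from repeated summation by parts ([exp_sum_bound]), and frequency 0 is a Riemann
sum ([riemann_sum]). *)

Set Implicit Arguments.
Unset Strict Implicit.
Unset Printing Implicit Defensive.

Import Order.TTheory GRing.Theory Num.Theory.
Import numFieldNormedType.Exports.
Import ComplexField.

Local Open Scope classical_set_scope.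
Local Open Scope ring_scope.
Local Open Scope complex_scope.

Local Notation cabs := Normc.normc.

(** * Moduli and the exponential map *)

Section Modulus.
Variable R : realType.
Implicit Types (x y : R) (z w : R[i]).

Lemma cabsD z w : cabs (z + w) <= cabs z + cabs w.
Proof. exact: le_normcD. Qed.

Lemma cabsN z : cabs (- z) = cabs z.
Proof. exact: normcN. Qed.

Lemma cabsB z w : cabs (z - w) <= cabs z + cabs w.
Proof. by rewrite -(cabsN w); exact: cabsD. Qed.

Lemma cabs_ge0 z : 0 <= cabs z.
Proof. by case: z => a b; exact: sqrtr_ge0. Qed.

Lemma cabs0 : cabs (0 : R[i]) = 0.
Proof. exact: Normc.normc0. Qed.

Lemma cabs1 : cabs (1 : R[i]) = 1.
Proof. exact: Normc.normc1. Qed.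

Lemma cabsM z w : cabs (z * w) = cabs z * cabs w.
Proof. exact: Normc.normcM. Qed.

Lemma cabs_real x : cabs x%:C = `|x|.
Proof. by rewrite /= expr0n /= addr0 sqrtr_sqr. Qed.

Lemma cabs_sum (I : Type) (s : seq I) (P : pred I) (F : I -> R[i]) :
  cabs (\sum_(i <- s | P i) F i) <= \sum_(i <- s | P i) cabs (F i).
Proof.
elim/big_ind2: _ => [|z1 x1 z2 x2 h1 h2|//]; first by rewrite cabs0.
by rewrite (le_trans (cabsD _ _)) ?lerD.
Qed.

Lemma cabs_prod (I : Type) (s : seq I) (P : pred I) (F : I -> R[i]) :
  cabs (\prod_(i <- s | P i) F i) = \prod_(i <- s | P i) cabs (F i).
Proof. by elim/big_ind2: _ => [|z1 x1 z2 x2 <- <-|//]; rewrite ?cabs1 ?cabsM. Qed.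

Lemma cabs_le_ReIm z : cabs z <= `|complex.Re z| + `|complex.Im z|.
Proof.
case: z => a b /=; rewrite -[X in _ <= X]ger0_norm ?addr_ge0// -sqrtr_sqr.
apply: ler_wsqrtr; rewrite sqrrD !real_normK ?num_real//.
by have := mulr_ge0 (normr_ge0 a) (normr_ge0 b); lra.
Qed.

Lemma sqr_cabs z : cabs z ^+ 2 = complex.Re z ^+ 2 + complex.Im z ^+ 2.
Proof. by case: z => a b /=; rewrite sqr_sqrtr// addr_ge0 ?sqr_ge0. Qed.

End Modulus.

Section MeanValue.
Variable R : realType.
Implicit Types (f df : R -> R) (x y K : R).

Lemma derive_MVT f df : (forall t : R, is_derive t (1 : R) f (df t)) ->
  forall x y, x <= y -> exists2 c, x <= c <= y & f y - f x = df c * (y - x).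
Proof.
move=> fdf x y xy.
have cf : {within `[x, y], continuous f}.
  apply: continuous_subspaceT => t.
  by apply/differentiable_continuous/derivable1_diffP.
have [c ci cE] := @MVT_segment R f df x y xy (fun t _ => fdf t) cf.
by exists c; rewrite // -in_itv.
Qed.

Lemma derive_bound_lip f df K : (forall t : R, is_derive t (1 : R) f (df t)) ->
  (forall t, `|df t| <= K) -> forall x y, `|f x - f y| <= K * `|x - y|.
Proof.
move=> fdf dfK x y.
wlog lexy : x y / x <= y.
  move=> H; case: (leP x y) => [|/ltW] h; first exact: H.
  by rewrite distrC (distrC x); exact: H.
have [c _ cE] := derive_MVT fdf lexy.
by rewrite distrC cE normrM (distrC x) ler_wpM2r.
Qed.

End MeanValue.

Section Exponential.
Variable R : realType.
Implicit Types (x y t : R) (n : int).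

Lemma echar0 : echar 0 = 1 :> R[i].
Proof. by rewrite /echar mulr0 cos0 sin0. Qed.

Lemma echarD x y : echar (x + y) = echar x * echar y.
Proof.
rewrite /echar mulrDr cosD sinD.
by apply/eqP; rewrite eq_complex /= eqxx addrC (mulrC (sin _) (cos _)) eqxx.
Qed.

Lemma cabs_echar x : cabs (echar x) = 1.
Proof. by rewrite /echar /= cos2Dsin2 sqrtr1. Qed.

Lemma echarNr x : echar x * echar (- x) = 1.
Proof. by rewrite -echarD subrr echar0. Qed.

Lemma echar_nat (k : nat) : echar k%:R = 1 :> R[i].
Proof.
elim: k => [|k IHk]; first exact: echar0.
rewrite -addn1 natrD echarD IHk mul1r /echar.
by rewrite mulr1 mulr_natl cos2pi sin2pi.
Qed.

Lemma echar_int n : echar n%:~R = 1 :> R[i].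
Proof.
case: n => k; first exact: echar_nat.
rewrite NegzE mulrNz -[LHS]mul1r -{1}(echar_nat k.+1).
exact: echarNr.
Qed.

Lemma echarDint x n : echar (x + n%:~R) = echar x.
Proof. by rewrite echarD echar_int mulr1. Qed.

Lemma echar_sum (I : Type) (s : seq I) (P : pred I) (F : I -> R) :
  echar (\sum_(i <- s | P i) F i) = \prod_(i <- s | P i) echar (F i).
Proof. exact: (big_morph _ echarD echar0). Qed.

Lemma cos_lip x y : `|cos x - cos y| <= `|x - y|.
Proof.
rewrite -[leRHS]mul1r; apply: (@derive_bound_lip R cos (fun t => - sin t)) => t.
by rewrite normrN; exact: sin_max.
Qed.

Lemma sin_lip x y : `|sin x - sin y| <= `|x - y|.
Proof.
rewrite -[leRHS]mul1r; apply: (@derive_bound_lip R sin cos) => t.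
exact: cos_max.
Qed.

Lemma echar_lip x y : cabs (echar x - echar y) <= 4 * pi * `|x - y|.
Proof.
apply: (le_trans (cabs_le_ReIm _)) => /=.
have -> : 4 * pi * `|x - y| = `|2 * pi * x - 2 * pi * y| + `|2 * pi * x - 2 * pi * y|.
  rewrite -mulrBr normrM ger0_norm; last by rewrite mulr_ge0// pi_ge0.
  by rewrite -mulrDl; ring.
by apply: lerD; [exact: cos_lip|exact: sin_lip].
Qed.

(** Halving the argument brings it into [0, pi/4], where the cosine is at least
1/2: the mean value theorem bounds the sine of the half angle from below. *)
Lemma sin_pi_ge t : 0 <= t <= 1 / 2 -> t / 2 <= sin (pi * t).
Proof.
move=> /andP[t0 t1].
have pi0 := pi_ge0 R; have pi2 := pi_ge2 R.
pose y := pi * t / 2.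
have y0 : 0 <= y by rewrite divr_ge0// mulr_ge0.
have y1 : y <= pi / 4.
  by rewrite /y -mulrA ler_wpM2l//; lra.
have cosy u : 0 <= u -> u <= y -> 1 / 2 <= cos u.
  move=> u0 uy.
  have c0 : 0 <= cos u.
    by apply: cos_ge0_pihalf; apply/andP; split; lra.
  have c2 : 0 <= cos (u *+ 2).
    by apply: cos_ge0_pihalf; rewrite (mulr2n u); apply/andP; split; lra.
  rewrite cos_mulr2n in c2; rewrite leNgt; apply/negP => h.
  have : cos u ^+ 2 < (1 / 2) ^+ 2 by rewrite ltr_pXn2r ?nnegrE//; lra.
  by move: c2; rewrite (mulr2n (_ ^+ 2)) !expr2; lra.
have siny : y / 2 <= sin y.
  have [c /andP[c0 cy] cE] := derive_MVT (@is_derive_sin R) y0.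
  move: cE; rewrite sin0 !subr0 => ->; rewrite mulrC ler_wpM2r//.
  by have := cosy c c0 cy; lra.
have -> : pi * t = y *+ 2 by rewrite (mulr2n y) /y; field.
rewrite sin_mulr2n -(mulr_natl (_ * _)).
have : 1 / 2 * (y / 2) <= cos y * sin y by apply: ler_pM; [lra|lra|exact: cosy|].
have : 2 * t <= pi * t by rewrite ler_wpM2r.
by rewrite /y; lra.
Qed.

Lemma echar_sub1_ge x n : `|x - n%:~R| <= 1 / 2 ->
  `|x - n%:~R| <= cabs (1 - echar x).
Proof.
move=> hx; set t := x - n%:~R.
have -> : echar x = echar t by rewrite -(echarDint t n) subrK.
rewrite -[X in _ <= X]ger0_norm ?cabs_ge0// -ler_sqr ?nnegrE//.
rewrite !real_normK ?num_real// sqr_cabs /=.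
have -> : 2 * pi * t = (pi * t) *+ 2 by rewrite (mulr2n (pi * t)); ring.
rewrite cos_mulr2n sin_mulr2n.
have h : `|t| / 2 <= `|sin (pi * t)|.
  have -> : `|sin (pi * t)| = `|sin (pi * `|t|)|.
    by case: (ger0P t) => ?; rewrite // mulrN sinN normrN.
  by apply: (le_trans (sin_pi_ge _)); rewrite ?hx ?normr_ge0//; exact: ler_norm.
have : (`|t| / 2) ^+ 2 <= `|sin (pi * t)| ^+ 2.
  by rewrite ler_pXn2r ?nnegrE// divr_ge0.
rewrite exprMn !real_normK ?num_real//.
have := cos2Dsin2 (pi * t); set c := cos _; set s := sin _ => cs.
have -> : (1 - (c ^+ 2 *+ 2 - 1)) ^+ 2 + (0 - (c * s) *+ 2) ^+ 2 = 4 * s ^+ 2.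
  have -> : c ^+ 2 *+ 2 - 1 = c ^+ 2 - s ^+ 2 by rewrite (mulr2n (_ ^+ 2)) -cs; ring.
  rewrite -{1}cs sub0r sqrrN (mulr2n (c * s)).
  have -> : c ^+ 2 + s ^+ 2 - (c ^+ 2 - s ^+ 2) = 2 * s ^+ 2 by ring.
  have -> : (2 * s ^+ 2) ^+ 2 + (c * s + c * s) ^+ 2 =
    4 * s ^+ 2 * (c ^+ 2 + s ^+ 2) by ring.
  by rewrite cs mulr1.
by rewrite expr2; lra.
Qed.

End Exponential.

(** * Symmetric sums over the integers *)

Section SymmetricSums.
Implicit Types (K : nat) (n m : int).

Definition cint K (i : 'I_(2 * K).+1) : int := i%:Z - K%:Z.

(** Symmetric windows are indexed by ordinals so that a product of such sums
expands over a type of finite functions. *)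
Definition isum (V : nmodType) K (F : int -> V) : V := \sum_i F (@cint K i).

Lemma cint_le K (i : 'I_(2 * K).+1) : `|cint i| <= K%:Z.
Proof. by rewrite /cint; have := ltn_ord i; lia. Qed.

Lemma cint_inj K : injective (@cint K).
Proof. by move=> i j; rewrite /cint => h; apply: val_inj => /=; lia. Qed.

Lemma cint_surj K m : `|m| <= K%:Z -> exists i, @cint K i = m.
Proof.
move=> h; have lt : (absz (m + K%:Z)%R < (2 * K).+1)%N by lia.
by exists (Ordinal lt); rewrite /cint /=; lia.
Qed.

Lemma eq_isum (V : nmodType) K (F G : int -> V) :
  (forall n, `|n| <= K%:Z -> F n = G n) -> isum K F = isum K G.
Proof. by move=> FG; apply: eq_bigr => i _; apply: FG; exact: cint_le. Qed.

Lemma isumS (V : nmodType) K (F : int -> V) :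
  isum K.+1 F = F (- K.+1%:Z) + isum K F + F K.+1%:Z.
Proof.
rewrite /isum /cint.
have -> : (2 * K.+1).+1 = (2 * K).+3 by lia.
rewrite big_ord_recl big_ord_recr /= addrA; congr (F _ + _ + F _); last by rewrite /bump; lia.
  by lia.
by apply: eq_bigr => i _; congr F; rewrite /= /bump; lia.
Qed.

Lemma isum_widen (V : nmodType) K K' (F : int -> V) : (K <= K')%N ->
  (forall n, K%:Z < `|n| -> F n = 0) -> isum K' F = isum K F.
Proof.
move=> /subnK <- F0; elim: (K' - K)%N => [//|k IHk].
by rewrite addSn isumS IHk !F0 ?addr0 ?add0r//; lia.
Qed.

(** A finitely supported sum may be computed in any window that contains the
support, so windows can be enlarged or tightened at will. *)
Lemma isum_supp (V : nmodType) K K' (F : int -> V) :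
  (forall n, F n != 0 -> `|n| <= K%:Z /\ `|n| <= K'%:Z) -> isum K F = isum K' F.
Proof.
move=> F0; wlog le : K K' F0 / (K <= K')%N.
  by move=> H; case: (leqP K K') => [|/ltnW] h; [|symmetry]; apply: H => // n /F0[].
symmetry; apply: isum_widen => // n nK; apply/eqP; apply: contraTT nK => /F0[].
by rewrite -leNgt.
Qed.

Lemma isum_shift (V : zmodType) K (F : int -> V) :
  isum K (fun n => F (n - 1)) + F K%:Z = F (- K.+1%:Z) + isum K F.
Proof.
pose G (i : nat) := F (i%:Z - K.+1%:Z).
transitivity (\sum_(i < (2 * K).+2) G i).
  rewrite big_ord_recr /= /isum /cint /G; congr (_ + F _); last by lia.
  by apply: eq_bigr => i _; congr F => /=; lia.
rewrite big_ord_recl /= /isum /cint /G; congr (F _ + _); first by lia.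
by apply: eq_bigr => i _; congr F; rewrite /= /bump; lia.
Qed.

Lemma isum_delta (V : zmodType) K m (G : int -> V) :
  isum K (fun n => G n *+ (n == m)) = G m *+ (`|m| <= K%:Z)%R.
Proof.
case: (boolP (`|m| <= K%:Z)) => [/cint_surj[i <-]|mK].
  rewrite /isum (bigD1 i)//= eqxx big1 ?addr0// => j ji.
  by rewrite (inj_eq (@cint_inj K)) (negbTE ji).
rewrite /isum big1// => j _; case: eqP => // jm.
by move: mK; rewrite -jm cint_le.
Qed.

Lemma exchange_isum (V : nmodType) K K' (F : int -> int -> V) :
  isum K (fun n => isum K' (F n)) = isum K' (fun m => isum K (F^~ m)).
Proof. exact: exchange_big. Qed.

Lemma isum_distrr (V : pzRingType) K c (F : int -> V) :
  c * isum K F = isum K (fun n => c * F n).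
Proof. exact: big_distrr. Qed.

Lemma isum_distrl (V : pzRingType) K c (F : int -> V) :
  isum K F * c = isum K (fun n => F n * c).
Proof. exact: big_distrl. Qed.

End SymmetricSums.

Section SymmetricSumsComplex.
Variable R : realType.

Definition nint (x : R) : int := Num.floor (x + 1 / 2).

(** The signed distance to the nearest integer; unlike [dist_int] it keeps apart
the two sides of an integer, so that it separates points modulo 1. *)
Definition sdist (x : R) : R := x - (nint x)%:~R.

Lemma sdist_le x : `|sdist x| <= 1 / 2.
Proof.
have /andP[] := floor_itv (x + 1 / 2).
by rewrite intrD ler_norml /sdist /nint => h1 h2; apply/andP; split; lra.
Qed.

Lemma cabs_isum K (F : int -> R[i]) :
  cabs (isum K F) <= isum K (fun n => cabs (F n)).
Proof. exact: cabs_sum. Qed.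

Lemma isum_le_const K (F : int -> R) (c : R) :
  (forall n, `|n| <= K%:Z -> F n <= c) -> isum K F <= (2 * K).+1%:R * c.
Proof.
move=> Fc; rewrite mulr_natl -[X in c *+ X]card_ord -sumr_const.
by apply: ler_sum => i _; apply: Fc; exact: cint_le.
Qed.

Lemma isum_real K (F : int -> R) : isum K (fun n => (F n)%:C) = (isum K F)%:C.
Proof. by rewrite /isum rmorph_sum. Qed.

(** Orthogonality of the additive characters modulo [2q+1].  Multiplying the sum by
[echar (u / Q)] permutes its terms cyclically, so the sum vanishes unless that
factor is 1. *)
Lemma isum_unity_root (q : nat) (u : int) : let Q := (2 * q).+1 in
  isum q (fun m => echar (m%:~R * (u%:~R / Q%:R)) : R[i])
    = Q%:R *+ (Q%:Z %| u)%Z.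
Proof.
move=> Q; set x : R := u%:~R / Q%:R.
have Q0 : Q%:R != 0 :> R by rewrite pnatr_eq0.
case: (boolP (Q%:Z %| u)%Z) => [/dvdzP[v uE]|ndiv].
  have -> : x = v%:~R by rewrite /x uE rmorphM /= pmulrn mulfK.
  rewrite /isum (eq_bigr (fun=> 1)); last by move=> i _; rewrite -intrM echar_int.
  by rewrite sumr_const card_ord.
apply/eqP; set S := isum _ _.
pose F m := echar (m%:~R * x) : R[i].
have FS m : F (m - 1) * echar x = F m.
  by rewrite /F -echarD; congr echar; rewrite rmorphB /=; ring.
have := isum_shift q F => sh.
have Fq : F (- q.+1%:Z) = F q%:Z.
  rewrite /F -(echarDint _ u); congr echar; rewrite /x /Q; field.
  by move: Q0; rewrite /Q -natr1 natrM addrC.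
rewrite Fq addrC in sh; move/addrI: sh => sh.
have : S * (1 - echar x) = 0.
  suff : isum q F * echar x = isum q F by rewrite mulrBr mulr1 -/S => ->; rewrite subrr.
  by rewrite -{1}sh isum_distrl; apply: eq_isum => m _; exact: FS.
move/eqP; rewrite mulf_eq0 => /orP[/eqP->//|/eqP ex].
case/negP: ndiv; set n := nint x.
have := echar_sub1_ge (sdist_le x); rewrite ex cabs0 normr_le0 subr_eq0 => /eqP xE.
apply/dvdzP; exists n; apply: (@intr_inj R).
by rewrite intrM -xE -pmulrn divfK.
Qed.

End SymmetricSumsComplex.

(** * Exponential sums of sampled smooth functions *)

Section SummationByParts.
Variable R : realType.
Implicit Types (f : R -> R) (A W : nat) (h T B x theta : R).

Definition supported T f := forall x, T < `|x| -> f x = 0.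

(** Uniform bounds are kept rather than the continuity of the last derivative:
summation by parts consumes them directly, and [bdiff] preserves them. *)
Fixpoint deriv_bounded A f B : Prop :=
  match A with
  | 0 => forall x, `|f x| <= B
  | A'.+1 => (forall x, derivable f x 1) /\ deriv_bounded A' (derive1 f) B
  end.

Definition bdiff h f : R -> R := fun x => f x - f (x - h).

Lemma is_derive_bdiff h f x : (forall y, derivable f y 1) ->
  is_derive x (1 : R) (bdiff h f) (bdiff h (derive1 f) x).
Proof.
move=> df; have d0 y : is_derive y (1 : R) f ((derive1 f) y).
  by rewrite derive1E; exact/derivableP.
have d1 : is_derive x (1 : R) (fun y : R => y - h) 1.
  by apply: is_derive_eq; rewrite subr0.
have d2 : is_derive x (1 : R) (fun y => f (y - h)) ((derive1 f) (x - h)).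
  have := @is_derive1_comp R f (fun y : R => y - h) x _ _ (d0 _) d1.
  by rewrite mulr1.
exact: is_deriveB.
Qed.

Lemma derive1_bdiff h f : (forall y, derivable f y 1) ->
  derive1 (bdiff h f) = bdiff h (derive1 f).
Proof.
move=> df; apply/funext => x; rewrite derive1E.
by have d := is_derive_bdiff h x df; rewrite derive_val.
Qed.

(** By the mean value theorem for the derivative of order [A]; differentiation
commutes with [bdiff], which settles the lower orders. *)
Lemma deriv_bounded_bdiff A h f B : 0 <= h ->
  deriv_bounded A.+1 f B -> deriv_bounded A (bdiff h f) (h * B).
Proof.
move=> h0; elim: A f => [|A IHA] f [df dB].
  move=> x; rewrite /bdiff; have -> : h * B = B * `|x - (x - h)|.
    by rewrite opprB addrC subrK ger0_norm// mulrC.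
  apply: (derive_bound_lip (df := (derive1 f))) => // t.
  by rewrite derive1E; exact/derivableP.
split; first by move=> x; have [] := is_derive_bdiff h x df.
by rewrite derive1_bdiff//; exact: IHA.
Qed.

Lemma supported_bdiff T h f : 0 <= h -> supported T f ->
  supported (T + h) (bdiff h f).
Proof.
move=> h0 fT x xTh; rewrite /bdiff !fT ?subrr//; last by lra.
by have := ler_normD (x - h) h; rewrite subrK (ger0_norm h0); lra.
Qed.

(** Multiplying the sum by [1 - echar theta] replaces the samples by their
backward differences, each of which gains a factor [h] over a derivative. *)
Lemma exp_sum_diff A f B T h theta W :
  deriv_bounded A f B -> supported T f -> 0 < h ->
  T + A%:R * h <= W%:R * h ->
  cabs (isum W (fun n => (f (n%:~R * h))%:C * echar (n%:~R * theta)))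
    * cabs (1 - echar theta) ^+ A <= (2 * W).+1%:R * (h ^+ A * B).
Proof.
elim: A f B T => [|A IHA] f B T fB fT h0 TW.
  rewrite !expr0 mulr1 mul1r (le_trans (cabs_isum _ _))//.
  by apply: isum_le_const => n _; rewrite cabsM cabs_echar mulr1 cabs_real.
rewrite exprS mulrA -cabsM.
set S := isum _ _.
pose G n := (f (n%:~R * h))%:C * echar ((n%:~R + 1) * theta).
have Wh : T < W%:R * h.
  by apply: (lt_le_trans _ TW); rewrite ltrDl mulr_gt0.
have G1 : G W%:Z = 0.
  by rewrite /G fT ?mul0r// ger0_norm -?pmulrn// mulr_ge0// ltW.
have G2 : G (- W.+1%:Z) = 0.
  rewrite /G fT ?mul0r// mulrNz mulNr normrN -pmulrn ger0_norm; last first.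
    by rewrite mulr_ge0// ltW.
  by apply: (lt_le_trans Wh); rewrite ler_pM2r// ler_nat.
have /esym Gsh := isum_shift W G; rewrite G1 G2 addr0 add0r in Gsh.
have -> : S * (1 - echar theta) =
    isum W (fun n => (bdiff h f (n%:~R * h))%:C * echar (n%:~R * theta)).
  rewrite mulrBr mulr1 isum_distrl.
  have -> : isum W (fun n => (f (n%:~R * h))%:C * echar (n%:~R * theta) * echar theta)
     = isum W G.
    by apply: eq_isum => n _; rewrite /G -mulrA -echarD mulrDl mul1r.
  rewrite Gsh /S /isum -sumrB; apply: eq_bigr => i _.
  rewrite /G /bdiff.
  have -> : (cint i - 1)%:~R = (cint i)%:~R - 1 :> R by rewrite intrB.
  rewrite subrK mulrBl mul1r.
  by rewrite [in RHS]rmorphB mulrBl.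
rewrite [h ^+ A.+1]exprSr -mulrA; apply: (IHA _ _ (T + h)) => //.
- by apply: deriv_bounded_bdiff => //; exact: ltW.
- by apply: supported_bdiff => //; exact: ltW.
- by move: TW; rewrite -natr1; lra.
Qed.

(** The window is shrunk to the support before summing by parts, so that the
number of nonzero terms is of order [1 / h] whatever the window was. *)
Lemma exp_sum_bound A f B T : 0 <= T ->
  (forall x, `|f x| <= B) -> deriv_bounded A f B -> supported T f ->
  exists2 C, 0 <= C & forall h theta W (n : int), 0 < h <= 1 ->
    T <= W%:R * h -> `|theta - n%:~R| <= 1 / 2 ->
    let S := cabs (isum W (fun n => (f (n%:~R * h))%:C * echar (n%:~R * theta))) in
    S * h <= C /\ S * h * (`|theta - n%:~R| / h) ^+ A <= C.
Proof.
move=> T0 fB dfB fT.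
have B0 : 0 <= B by exact: le_trans (normr_ge0 _) (fB 0).
exists ((2 * T + 2 * A%:R + 3) * B).
  by rewrite mulr_ge0// !addr_ge0// mulr_ge0.
move=> h theta W n /andP[h0 h1] TW tn.
set c := 2 * T + 2 * A%:R + 3.
pose W0 := (Num.trunc (T / h) + A + 1)%N.
have Th0 : 0 <= T / h by rewrite divr_ge0// ltW.
have /andP[W1 W2] := trunc_itv Th0.
have TW0 : T + A%:R * h <= W0%:R * h.
  rewrite -ler_pdivrMr// mulrDl mulfK ?gt_eqF// /W0 -addnA addnCA addnC natrD.
  by rewrite lerD2r ltW// addn1.
have W0c : (2 * W0).+1%:R * h <= c.
  rewrite -natr1 natrM /W0 !natrD mulrDl mul1r.
  have : (Num.trunc (T / h))%:R * h <= T by rewrite -ler_pdivlMr.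
  have : A%:R * h <= A%:R by rewrite ler_piMr.
  by rewrite /c; lra.
set F := fun n : int => _.
have -> : isum W F = isum W0 F.
  have T1 : T <= W0%:R * h.
    by apply: le_trans TW0; rewrite lerDl mulr_ge0// ltW.
  have supp V m : T <= V%:R * h -> F m != 0 -> `|m| <= V%:Z.
    move=> TV; apply: contraNT; rewrite -ltNge => Vm; apply/eqP.
    rewrite /F fT ?mul0r//; apply: (le_lt_trans TV).
    rewrite normrM (gtr0_norm h0) ltr_pM2r// pmulrn -intr_norm ltr_int.
    exact: Vm.
  by apply: isum_supp => m Fm; split; exact: supp.
have Sd := exp_sum_diff theta dfB fT h0 TW0; rewrite -/F in Sd.
have S0 : cabs (isum W0 F) <= (2 * W0).+1%:R * B.
  rewrite (le_trans (cabs_isum _ _))//.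
  by apply: isum_le_const => m _; rewrite cabsM cabs_echar mulr1 cabs_real.
split.
  by rewrite (le_trans (ler_wpM2r (ltW h0) S0))// mulrAC ler_wpM2r.
have hA : 0 < h ^+ A by exact: exprn_gt0.
rewrite expr_div_n mulrA ler_pdivrMr//.
have : cabs (isum W0 F) * `|theta - n%:~R| ^+ A <= (2 * W0).+1%:R * (h ^+ A * B).
  apply: le_trans Sd; rewrite ler_wpM2l ?cabs_ge0//.
  by apply: lerXn2r; rewrite ?nnegrE ?cabs_ge0//; exact: echar_sub1_ge.
set M := (2 * W0).+1%:R in W0c *; set tA := _ ^+ A => SM.
have -> : cabs (isum W0 F) * h * tA = (cabs (isum W0 F) * tA) * h by ring.
have -> : c * B * h ^+ A = c * (h ^+ A * B) by ring.
apply: (le_trans (ler_wpM2r (ltW h0) SM)).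
by rewrite mulrAC; apply: ler_wpM2r => //; rewrite mulr_ge0// ltW.
Qed.

End SummationByParts.

(** * Riemann sums *)

Section RiemannSums.
Variable R : realType.
Implicit Types (f : R -> R) (h T x : R).
Notation mu := (@lebesgue_measure R).

Lemma supported_patch f T : supported T f -> f \_ `[- T, T] = f.
Proof.
move=> fT; apply/funext => x; rewrite patchE; case: ifPn => //= xT.
rewrite fT// ltNge; apply/negP => xT'; case/negP: xT.
by rewrite inE /= in_itv /= -ler_norml.
Qed.

Lemma integrable_supported f T : continuous f -> supported T f ->
  mu.-integrable setT (EFin \o f).
Proof.
move=> cf fT; rewrite -(supported_patch fT) -restrict_EFin.
apply/integrable_restrict => //=; rewrite setTI.
by apply: continuous_compact_integrable; [exact: segment_compact|exact: continuous_subspaceT].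
Qed.

(** Integrating from minus infinity makes the fundamental theorem of calculus
available at every point, with no endpoint to single out. *)
Lemma supported_antiderivative f T : continuous f -> supported T f ->
  exists G : R -> R, [/\ forall x : R, is_derive x (1 : R) G (f x),
    forall x, x < - T -> G x = 0 & forall x, T < x -> G x = Rintegral mu setT f].
Proof.
move=> cf fT.
pose G x := Rintegral mu [set` Interval -oo%O (BRight x)] f.
exists G; split=> x.
- have xx : x < x + 1 by rewrite ltrDl.
  have fi : mu.-integrable [set` Interval -oo%O (BRight (x + 1))] (EFin \o f).
    by apply: integrableS (integrable_supported cf fT).
  have [dG <-] := continuous_FTC1 xx fi (ltNyr _) (cf x).
  by rewrite derive1E; exact/derivableP.
- move=> xT; rewrite /G (@eq_Rintegral _ _ _ mu _ (fun=> 0)).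
    by rewrite Rintegral_cst// mul0r.
  move=> t; rewrite inE /= in_itv /= => tx; apply: fT.
  by rewrite -normrN; apply: lt_le_trans (ler_norm _); lra.
move=> xT; rewrite /G Rintegral_mkcond; congr Rintegral; apply/funext => t.
rewrite patchE; case: ifPn => // tx; rewrite fT//.
move: tx; rewrite notin_setE /= in_itv /= => /negP; rewrite -ltNge => xt.
by apply: lt_le_trans (ler_norm _); exact: lt_trans xt.
Qed.

Lemma isum_telescope W (G : int -> R) :
  isum W (fun n => G (n + 1) - G n) = G (W%:Z + 1) - G (- W%:Z).
Proof.
have sh : isum W G + G (W%:Z + 1) = G (- W%:Z) + isum W (fun n => G (n + 1)).
  have := isum_shift W (fun n => G (n + 1)).
  have -> : - W.+1%:Z + 1 = - W%:Z by lia.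
  have -> // : isum W (fun n => G (n - 1 + 1)) = isum W G.
  by apply: eq_isum => n _; rewrite subrK.
transitivity (isum W (fun n => G (n + 1)) - isum W G); first exact: sumrB.
by move: sh; lra.
Qed.

(** By the mean value theorem, each term is the increment of an antiderivative up
to [O(h ^ 2)], and there are [O(1 / h)] nonzero terms. *)
Lemma riemann_sum f df K T : 0 <= T -> supported T f ->
  (forall x : R, is_derive x (1 : R) f (df x)) -> (forall x, `|df x| <= K) ->
  forall h W, 0 < h <= 1 -> T <= W%:R * h ->
  `|h * isum W (fun n => f (n%:~R * h)) - Rintegral mu setT f|
    <= (2 * T + 3) * K * h.
Proof.
move=> T0 fT fdf dfK h W /andP[h0 h1] TW.
have K0 : 0 <= K by exact: le_trans (normr_ge0 _) (dfK 0).
have flip := derive_bound_lip fdf dfK.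
have cf : continuous f.
  by move=> x; apply/differentiable_continuous/derivable1_diffP.
have [G [dG G0 GI]] := supported_antiderivative cf fT.
pose W0 := (Num.trunc (T / h)).+1.
have Th0 : 0 <= T / h by rewrite divr_ge0// ltW.
have /andP[W1 W2] := trunc_itv Th0.
have TW0 : T < W0%:R * h by rewrite -ltr_pdivrMr.
have W0c : (2 * W0).+1%:R * h <= 2 * T + 3.
  rewrite -natr1 natrM /W0 -natr1.
  have : (Num.trunc (T / h))%:R * h <= T by rewrite -ler_pdivlMr.
  by lra.
have -> : isum W (fun n => f (n%:~R * h)) = isum W0 (fun n => f (n%:~R * h)).
  have supp V m : T <= V%:R * h -> f (m%:~R * h) != 0 -> `|m| <= V%:Z.
    move=> TV; apply: contraNT; rewrite -ltNge => Vm; apply/eqP.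
    rewrite fT//; apply: (le_lt_trans TV).
    rewrite normrM (gtr0_norm h0) ltr_pM2r// pmulrn -intr_norm ltr_int.
    exact: Vm.
  by apply: isum_supp => m Fm; split; apply: supp => //; exact: ltW.
have <- : isum W0 (fun n => G ((n + 1)%:~R * h) - G (n%:~R * h)) =
    Rintegral mu setT f.
  rewrite (isum_telescope W0 (fun n => G (n%:~R * h))) GI ?G0 ?subr0//.
    by rewrite intrN mulNr ltrN2 -pmulrn.
  by apply: (lt_trans TW0); rewrite ltr_pM2r// pmulrn ltr_int ltrDl.
rewrite isum_distrr /isum -sumrB (le_trans (ler_norm_sum _ _ _))//.
apply: (@le_trans _ _ (isum W0 (fun=> h * (K * h)))).
  apply: ler_sum => i _; set n := cint i.
  have nn : n%:~R * h <= (n + 1)%:~R * h by rewrite ler_pM2r// ler_int lerDl.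
  have [c /andP[c1 c2] ->] := derive_MVT dG nn.
  have nE : (n + 1)%:~R * h = n%:~R * h + h by rewrite intrD mulrDl mul1r.
  have -> : (n + 1)%:~R * h - n%:~R * h = h by rewrite nE addrAC subrr add0r.
  rewrite mulrC -mulrBl normrM mulrC (gtr0_norm h0) ler_wpM2l ?(ltW h0)//.
  apply: (le_trans (flip _ _)); rewrite ler_wpM2l//.
  by rewrite distrC ger0_norm ?subr_ge0//; lra.
rewrite (le_trans (isum_le_const (c := h * (K * h)) _))//.
have -> : (2 * T + 3) * K * h = (2 * T + 3) * (K * h) by ring.
by rewrite mulrA ler_wpM2r// mulr_ge0// ltW.
Qed.

End RiemannSums.

(** * Trigonometric approximation of periodised functions *)

Section TrigonometricApproximation.
Variable R : realType.
Implicit Types (f : R -> R) (A : nat) (T : R).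

(** The bound of order 1 gives Lipschitz estimates and Riemann sums, that of order
[A] gives the decay of exponential sums. *)
Definition smooth_bump A T f := supported T f /\
  exists B, [/\ forall x, `|f x| <= B, deriv_bounded 1 f B & deriv_bounded A f B].

(** The terms [m] and [- m] together are at most the increment of [- 4 / (m + 1)]
from [m - 1] to [m].  The term [m = 0] is 0, as the inverse of 0 is. *)
Lemma isum_inv_sq q : isum q (fun m => (`|m|%:~R : R) ^- 2) <= 4.
Proof.
suff : isum q (fun m => (`|m|%:~R : R) ^- 2) <= 4 - 4 / q.+1%:R.
  by move=> /le_trans; apply; rewrite gerBl divr_ge0.
elim: q => [|q IHq].
  by rewrite /isum big_ord_recl big_ord0 addr0 /cint /= expr0n /= invr0 divr1 subrr.
rewrite isumS normrN gtr0_norm// -pmulrn.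
have -> : q.+2%:R = q.+1%:R + 1 :> R by rewrite natr1.
set x : R := q.+1%:R in IHq *.
have x1 : 1 <= x by rewrite /x ler1n.
set S := isum _ _ in IHq *.
have h : 2 * x ^- 2 <= 4 / x - 4 / (x + 1).
  rewrite -subr_ge0.
  have -> : 4 / x - 4 / (x + 1) - 2 * x ^- 2 = 2 * (x - 1) / (x ^+ 2 * (x + 1)).
    by field; apply/andP; split; lra.
  by rewrite divr_ge0 ?mulr_ge0 ?exprn_ge0//; lra.
by move: IHq h; move: (x ^- 2) (4 / x) (4 / (x + 1)) S => a b c S; lra.
Qed.

Section Sampling.
Variables (f : R -> R) (rho : R) (q W : nat).
Local Notation Q := ((2 * q).+1%:R : R).
Let h := (Q * rho)^-1.

(** A discrete Fourier coefficient, on the grid of mesh [1 / Q], of the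
periodisation of [x |-> f (x / rho)]: unfolding the periodisation turns the sum
over one period into a sum over all sample points. *)
Definition sample_coeff (m : int) : R[i] :=
  (Q^-1)%:C * isum W (fun n => (f (n%:~R * h))%:C * echar (n%:~R * (- m%:~R / Q))).

(** Discrete Fourier inversion: orthogonality keeps the sample points that are
congruent to [j] modulo [Q], which are the translates of [j / Q] by integers. *)
Lemma sample_inversion T K (j : int) : 0 < rho -> supported T f ->
  T <= W%:R * h -> T * rho + `|j%:~R / Q| <= K%:R ->
  isum q (fun m => sample_coeff m * echar (m%:~R * (j%:~R / Q)))
    = (isum K (fun a => f ((a%:~R + j%:~R / Q) / rho)))%:C.
Proof.
move=> rho0 fT TW TK.
have Q0 : 0 < Q by rewrite ltr0n.
have h0 : 0 < h by rewrite invr_gt0 mulr_gt0.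
transitivity (isum W (fun n => (f (n%:~R * h) *+ ((2 * q).+1 %| (j - n)%R)%Z)%:C)).
  transitivity (isum q (fun m => isum W (fun n => (Q^-1)%:C *
      ((f (n%:~R * h))%:C * echar (n%:~R * (- m%:~R / Q))) *
      echar (m%:~R * (j%:~R / Q))))).
    by apply: eq_isum => m _; rewrite /sample_coeff isum_distrr isum_distrl.
  rewrite exchange_isum; apply: eq_isum => n _.
  transitivity ((Q^-1)%:C * (f (n%:~R * h))%:C *
     isum q (fun m => echar (m%:~R * ((j - n)%:~R / Q)))).
    rewrite isum_distrr; apply: eq_isum => m _.
    rewrite -!mulrA; congr (_ * (_ * _)); rewrite -echarD; congr echar.
    by rewrite intrB; ring.
  rewrite isum_unity_root; case: (_ %| _)%Z; last by rewrite !mulr0n mulr0.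
  rewrite !mulr1n mulrAC.
  have -> : (2 * q).+1%:R = Q%:C by rewrite rmorph_nat.
  by rewrite -rmorphM mulVf ?gt_eqF// rmorph1 mul1r.
rewrite isum_real; congr (_%:C).
pose F (n a : int) : R := f (n%:~R * h) *+ (n == a * (2 * q).+1%:Z + j).
transitivity (isum W (fun n => isum K (F n))); last first.
  rewrite exchange_isum; apply: eq_isum => a _.
  rewrite /F (isum_delta W _ (fun n => f (n%:~R * h))).
  have -> : (a%:~R + j%:~R / Q) / rho = (a * (2 * q).+1%:Z + j)%:~R * h.
    rewrite intrD intrM -pmulrn /h; field.
    by rewrite gt_eqF//= addrC natr1 -natrM; rewrite gt_eqF.
  set n := _ + j; case: leP => [_|Wn]; first by rewrite mulr1n.
  rewrite mulr0n fT//; apply: (le_lt_trans TW).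
  rewrite normrM (gtr0_norm h0) ltr_pM2r// pmulrn -intr_norm ltr_int.
  exact: Wn.
apply: eq_isum => n _; rewrite /F.
have [fn0|fn0] := eqVneq (f (n%:~R * h)) 0.
  by rewrite fn0 mul0rn /isum big1// => i _; rewrite mul0rn.
have nT : `|n%:~R| * h <= T.
  rewrite -(gtr0_norm h0) -normrM leNgt; apply/negP => /fT.
  by move/eqP; rewrite (negbTE fn0).
case: (boolP (_ %| _)%Z) => [/dvdzP[b bE]|ndiv]; last first.
  rewrite mulr0n /isum big1// => i _; case: eqP => // nE; case/negP: ndiv.
  by apply/dvdzP; exists (- cint i); lia.
have -> : n = j - b * (2 * q).+1%:Z by lia.
rewrite mulr1n.
under eq_isum => a _.
  have -> : (j - b * (2 * q).+1%:Z == a * (2 * q).+1%:Z + j) = (a == - b).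
    apply/eqP/eqP => [e|->]; last by ring.
    have /eqP : (a + b) * (2 * q).+1%:Z = 0 by rewrite mulrDl; lia.
    by rewrite mulf_eq0 => /orP[/eqP|]//; lia.
  over.
rewrite (isum_delta K (- b) (fun=> f _)).
suff -> : (`|- b| <= K%:Z)%R by [].
rewrite normrN -(ler_int R) intr_norm -pmulrn (le_trans _ TK)//.
have -> : b%:~R = j%:~R / Q - n%:~R / Q :> R.
  by rewrite -mulrBl -intrB bE intrM -pmulrn mulfK ?gt_eqF.
rewrite (addrC (T * rho)) (le_trans (ler_normB _ _))// lerD2l normrM normfV (gtr0_norm Q0).
have -> : `|n%:~R| / Q = (`|n%:~R| * h) * rho.
  by rewrite /h invfM mulrA divfK// gt_eqF.
by rewrite ler_wpM2r// ltW.
Qed.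

End Sampling.

(** The frequency [- m / Q] has 0 as nearest integer, since [`|m| <= q < Q / 2];
summation by parts in steps [1 / (Q * rho)] thus gives decay in [rho * m]. *)
Lemma sample_coeff_bounds A T f : 0 <= T -> smooth_bump A T f ->
  exists2 C, 0 <= C & forall rho q W (m : int), 0 < rho ->
    1 <= (2 * q).+1%:R * rho -> T <= W%:R * ((2 * q).+1%:R * rho)^-1 ->
    `|m| <= q%:Z ->
    cabs (sample_coeff f rho q W m) <= C * rho /\
    cabs (sample_coeff f rho q W m) * (rho * `|m%:~R|) ^+ A <= C * rho.
Proof.
move=> T0 [fT [B [fB _ dfB]]].
have [C C0 HC] := exp_sum_bound T0 fB dfB fT; exists C => // rho q W m rho0.
set Q : R := (2 * q).+1%:R => Qrho TW mq.
have Q0 : 0 < Q by rewrite ltr0n.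
have Qrho0 : 0 < Q * rho by rewrite mulr_gt0.
have hQ : 0 < (Q * rho)^-1 <= 1 by rewrite invr_gt0 Qrho0 invf_le1.
have mQ : `|- m%:~R / Q - 0%:~R| <= 1 / 2.
  rewrite subr0 mulNr normrN normrM normfV (gtr0_norm Q0) ler_pdivrMr//.
  rewrite -intr_norm; have : `|m|%:~R <= q%:R :> R by rewrite pmulrn ler_int.
  have -> : Q = 2 * q%:R + 1 by rewrite /Q -natr1 natrM.
  by lra.
have [] := HC _ (- m%:~R / Q) W 0 hQ TW mQ.
set S := cabs _ => S1 S2.
have -> : cabs (sample_coeff f rho q W m) = S / (Q * rho) * rho.
  transitivity (Q^-1 * S); last by rewrite invfM mulrA divfK ?gt_eqF// mulrC.
  by rewrite /sample_coeff cabsM cabs_real gtr0_norm ?invr_gt0.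
split; first by rewrite ler_wpM2r// ltW.
rewrite mulrAC ler_wpM2r ?(ltW rho0)//; apply: le_trans S2.
rewrite subr0 mulNr normrN normrM normfV (gtr0_norm Q0) invrK.
by rewrite mulrA divfK ?gt_eqF// (mulrC rho).
Qed.

Lemma sample_coeff0 A T f : 0 <= T -> smooth_bump A T f ->
  exists2 C, 0 <= C & forall rho q W, 0 < rho ->
    1 <= (2 * q).+1%:R * rho -> T <= W%:R * ((2 * q).+1%:R * rho)^-1 ->
    cabs (sample_coeff f rho q W 0 - (rho * Rintegral lebesgue_measure setT f)%:C)
      <= C / (2 * q).+1%:R.
Proof.
move=> T0 [fT [B [fB [df dfB] _]]].
have B0 : 0 <= B by exact: le_trans (normr_ge0 _) (fB 0).
exists ((2 * T + 3) * B); first by rewrite mulr_ge0// addr_ge0// mulr_ge0.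
move=> rho q W rho0; set Q : R := (2 * q).+1%:R => Qrho TW.
have Q0 : 0 < Q by rewrite ltr0n.
have Qrho0 : 0 < Q * rho by rewrite mulr_gt0.
have hQ : 0 < (Q * rho)^-1 <= 1 by rewrite invr_gt0 Qrho0 invf_le1.
have fdf x : is_derive x (1 : R) f (derive1 f x).
  by rewrite derive1E; exact/derivableP.
have rs := riemann_sum T0 fT fdf dfB hQ TW.
rewrite /sample_coeff.
have -> : isum W (fun n => (f (n%:~R * (Q * rho)^-1))%:C *
    echar (n%:~R * (- 0%:~R / Q))) = (isum W (fun n => f (n%:~R * (Q * rho)^-1)))%:C.
  rewrite -isum_real; apply: eq_isum => n _.
  by rewrite oppr0 mul0r mulr0 echar0 mulr1.
set S := isum _ _ in rs *.
rewrite -rmorphM -rmorphB cabs_real.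
have -> : Q^-1 * S - rho * Rintegral lebesgue_measure setT f =
    rho * ((Q * rho)^-1 * S - Rintegral lebesgue_measure setT f).
  have e x y a b : 0 < a -> 0 < b ->
      a^-1 * x - b * y = b * ((a * b)^-1 * x - y) :> R.
    by move=> a0 b0; field; rewrite !gt_eqF.
  exact: e.
rewrite normrM (gtr0_norm rho0) (le_trans (ler_wpM2l (ltW rho0) rs))//.
have e x a b : 0 < a -> 0 < b -> b * (x * (a * b)^-1) = x / a :> R.
  by move=> a0 b0; field; rewrite !gt_eqF.
by rewrite e.
Qed.

(** A smooth function periodised to period 1 is the limit of trigonometric
polynomials whose coefficients decay like its Fourier coefficients.  They come
from a discrete Fourier transform on a grid of mesh [1 / (2q+1)]; it is exact at
the grid points, and both sides are Lipschitz in between, the trigonometric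
polynomial uniformly in [q] because its coefficients are [O(|m| ^ -3)]. *)
Lemma periodization_approx A T f : (3 <= A)%N -> 0 <= T -> smooth_bump A T f ->
  exists2 C, 0 <= C & forall rho Y K e, 0 < rho -> 0 <= Y -> 0 < e ->
    T * rho + Y + 1 <= K%:R ->
  exists q0, forall q, (q0 <= q)%N -> exists c : int -> R[i],
  [/\ forall m, `|m| <= q%:Z -> cabs (c m) <= C * rho /\
        cabs (c m) * (rho * `|m%:~R|) ^+ A <= C * rho,
     cabs (c 0 - (rho * Rintegral lebesgue_measure setT f)%:C) <= e &
     forall y, `|y| <= Y ->
       cabs ((isum K (fun a => f ((a%:~R + y) / rho)))%:C
             - isum q (fun m => c m * echar (m%:~R * y))) <= e].
Proof.
move=> A3 T0 fbump.
have [C C0 HC] := sample_coeff_bounds T0 fbump.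
have [D D0 HD] := sample_coeff0 T0 fbump.
case: fbump => fT [B [fB [df dfB] _]].
have B0 : 0 <= B by exact: le_trans (normr_ge0 _) (fB 0).
have fdf x : is_derive x (1 : R) f (derive1 f x).
  by rewrite derive1E; exact/derivableP.
have flip := derive_bound_lip fdf dfB.
exists C => // rho Y K e rho0 Y0 e0 TYK.
pose E := D + ((2 * K).+1%:R * (B / rho) + 4 * pi * (C * rho / rho ^+ A * 4)).
have E1 : 0 <= (2 * K).+1%:R * (B / rho).
  by rewrite mulr_ge0// divr_ge0// ltW.
have E2 : 0 <= 4 * pi * (C * rho / rho ^+ A * 4).
  rewrite !mulr_ge0// ?invr_ge0 ?exprn_ge0 ?(ltW rho0)//; exact: pi_ge0.
exists (Num.trunc (E / e) + Num.trunc rho^-1 + 2)%N => q qle.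
have [q1 q2] : (Num.trunc (E / e) < 2 * q)%N /\ (Num.trunc rho^-1 < 2 * q)%N.
  by move: (Num.trunc _) (Num.trunc _) qle => n1 n2; clear; lia.
set Q : R := (2 * q).+1%:R.
have Q0 : 0 < Q by rewrite ltr0n.
have truncS (x : R) : 0 <= x -> x <= (Num.trunc x).+1%:R.
  by move=> /trunc_itv/andP[_ /ltW].
have QE : E / Q <= e.
  rewrite ler_pdivrMr// mulrC -ler_pdivrMr//.
  rewrite (le_trans (truncS _ _))//; first by rewrite divr_ge0 ?addr_ge0// ltW.
  by rewrite ler_nat ltnW.
have Qrho : 1 <= Q * rho.
  rewrite -ler_pdivrMr// mul1r (le_trans (truncS _ _)) ?invr_ge0 ?(ltW rho0)//.
  by rewrite ler_nat ltnW.
pose W := (Num.trunc (T * (Q * rho))).+1.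
have Qrho0 : 0 < Q * rho by rewrite mulr_gt0.
have TW : T <= W%:R * (Q * rho)^-1.
  by rewrite ler_pdivlMr// truncS// mulr_ge0// ltW.
exists (sample_coeff f rho q W).
have DE : D <= E by rewrite lerDl addr_ge0.
split.
- by move=> m mq; exact: HC.
- apply: (le_trans (HD _ _ _ _ Qrho TW)) => //.
  by apply: le_trans QE; rewrite ler_wpM2r// invr_ge0 ltW.
move=> y yY; pose j := Num.floor (y * Q).
have /andP[j1 j2] := floor_itv (y * Q); rewrite -/j intrD in j1 j2.
have jy : `|y - j%:~R / Q| <= Q^-1.
  rewrite ger0_norm ?subr_ge0 ?ler_pdivrMr//.
  by rewrite lerBlDr -[X in X + _]mul1r -mulrDl ler_pdivlMr// addrC ltW.
have Q1 : Q^-1 <= 1 by rewrite invf_le1// ler1n.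
have jK : T * rho + `|j%:~R / Q| <= K%:R.
  apply: le_trans TYK; rewrite -addrA lerD2l.
  have <- : y - (y - j%:~R / Q) = j%:~R / Q by rewrite opprB addrC subrK.
  by rewrite (le_trans (ler_normB _ _))// lerD// (le_trans jy).
have inv := sample_inversion rho0 fT TW jK.
set c := sample_coeff f rho q W in inv *.
set F := fun x => isum K (fun a => f ((a%:~R + x) / rho)).
set P := fun x => isum q (fun m => c m * echar (m%:~R * x)).
have FP : (F (j%:~R / Q))%:C = P (j%:~R / Q) by rewrite /P inv.
rewrite -/(F y) -/(P y).
have -> : (F y)%:C - P y = (F y - F (j%:~R / Q))%:C - (P y - P (j%:~R / Q)).
  by rewrite rmorphB /= FP; ring.
rewrite (le_trans (cabsB _ _))// cabs_real.
apply: le_trans QE; rewrite /E mulrDl -[leLHS]add0r lerD//.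
  by rewrite divr_ge0// ltW.
rewrite mulrDl lerD//.
  rewrite /F /isum -sumrB (le_trans (ler_norm_sum _ _ _))//.
  rewrite -mulrA; apply: (isum_le_const (F := fun a =>
    `|f ((a%:~R + y) / rho) - f ((a%:~R + j%:~R / Q) / rho)|)) => a _.
  rewrite (le_trans (flip _ _))// -mulrA ler_wpM2l// -mulrBl.
  rewrite normrM normfV (gtr0_norm rho0) mulrC ler_wpM2l ?invr_ge0 ?(ltW rho0)//.
  by rewrite opprD addrACA subrr add0r.
rewrite /P /isum -sumrB (le_trans (cabs_sum _ _ _))//.
have step m : `|m| <= q%:Z ->
    cabs (c m * echar (m%:~R * y) - c m * echar (m%:~R * (j%:~R / Q))) <=
    4 * pi / Q * (C * rho / rho ^+ A * `|m|%:~R ^- 2).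
  move=> mq; rewrite -mulrBr cabsM.
  have [->|m0] := eqVneq m 0.
    by rewrite !mul0r subrr cabs0 mulr0 normr0 expr0n /= invr0 !mulr0.
  have M1 : 1 <= `|m|%:~R :> R by rewrite ler1z -gtz0_ge1 normr_gt0.
  set M : R := `|m|%:~R in M1 *.
  have el := echar_lip (m%:~R * y) (m%:~R * (j%:~R / Q)).
  rewrite -mulrBr normrM -intr_norm -/M in el.
  have el2 : cabs (echar (m%:~R * y) - echar (m%:~R * (j%:~R / Q))) <= 4 * pi * (M * Q^-1).
    apply: (le_trans el); rewrite ler_wpM2l ?mulr_ge0 ?pi_ge0//.
    by rewrite ler_wpM2l// (le_trans _ M1).
  apply: (le_trans (ler_wpM2l (cabs_ge0 _) el2)).
  have -> : cabs (c m) * (4 * pi * (M * Q^-1)) = 4 * pi / Q * (cabs (c m) * M) by ring.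
  rewrite ler_wpM2l ?divr_ge0 ?mulr_ge0 ?pi_ge0 ?(ltW Q0)//.
  have [_] := HC rho q W m rho0 Qrho TW mq; rewrite -/c exprMn -intr_norm -/M.
  have M0 : 0 < M by exact: lt_le_trans M1.
  rewrite mulrCA mulrC -ler_pdivlMr ?exprn_gt0// => cm.
  have -> : cabs (c m) * M = cabs (c m) * M ^+ 3 * M ^- 2.
    by field; rewrite gt_eqF.
  rewrite ler_wpM2r ?invr_ge0 ?exprn_ge0 ?(ltW M0)//.
  by apply: le_trans cm; rewrite ler_wpM2l ?cabs_ge0// ler_weXn2l.
apply: (@le_trans _ _ (isum q (fun m => 4 * pi / Q * (C * rho / rho ^+ A * `|m|%:~R ^- 2)))).
  by apply: ler_sum => i _; apply: step; exact: cint_le.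
rewrite -!isum_distrr [leRHS]mulrAC ler_wpM2l ?divr_ge0 ?mulr_ge0 ?pi_ge0 ?(ltW Q0)//.
by rewrite ler_wpM2l ?isum_inv_sq// divr_ge0 ?mulr_ge0 ?exprn_ge0 ?(ltW rho0).
Qed.

End TrigonometricApproximation.

(** * Sums over separated frequencies *)

Section SeparatedSums.
Variable R : realType.

(** Bounding [t i] below by [delta] times its integer part [k i >= 1], and the
square by a product of consecutive factors, leaves a telescoping sum; the [k i]
are distinct by separation. *)
Lemma separated_sum_pos (I : finType) (P : pred I) (t : I -> R) (delta N : R) :
  0 < delta -> 0 < N -> (forall i, P i -> delta <= t i) ->
  (forall i j, P i -> P j -> i != j -> delta <= `|t i - t j|) ->
  \sum_(i | P i) N / (1 + N * t i) ^+ 2 <= delta^-1.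
Proof.
move=> delta0 N0 tdelta tsep.
pose k i := Num.trunc (t i / delta).
have kP i : P i -> (k i)%:R * delta <= t i < (k i).+1%:R * delta.
  move=> /tdelta ti; rewrite -ler_pdivlMr// -ltr_pdivrMr//.
  by apply: trunc_itv; rewrite divr_ge0 ?(ltW delta0)// (le_trans (ltW delta0)).
have k1 i : P i -> (0 < k i)%N.
  move=> Pi; have /andP[_] := kP i Pi; rewrite ltNge; case: posnP => // ->.
  by rewrite mul1r tdelta.
pose u (n : nat) : R := (1 + N * (n%:R * delta))^-1.
have u1 (n : nat) : 0 < 1 + N * (n%:R * delta).
  by rewrite ltr_wpDr// mulr_ge0 ?mulr_ge0// ltW.
have u0 n : 0 < u n by rewrite invr_gt0.
have udec n : u n.+1 <= u n.
  rewrite lef_pV2 ?posrE// lerD2l ler_wpM2l ?(ltW N0)// ler_wpM2r ?(ltW delta0)//.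
  by rewrite ler_nat.
pose M := (\max_i k i)%N.
have kM i : ((k i).-1 < M.+1)%N.
  by rewrite ltnS (leq_trans (leq_pred _))// /M leq_bigmax.
pose f i : 'I_M.+1 := Ordinal (kM i).
pose g (n : nat) : R := delta^-1 * (u n - u n.+1).
have finj : {in P &, injective f}.
  move=> i j Pi Pj /(congr1 val) /= kij; apply/eqP/negPn/negP => ij.
  have {}kij : k i = k j by rewrite -(prednK (k1 _ Pi)) kij prednK// k1.
  have /andP[a1 a2] := kP i Pi; have /andP[b1 b2] := kP j Pj.
  rewrite kij in a1 a2.
  have := tsep i j Pi Pj ij; rewrite leNgt => /negP; apply.
  by rewrite -natr1 mulrDl mul1r in a2 b2; rewrite ltr_norml; apply/andP; split; lra.
apply: (@le_trans _ _ (\sum_(i | P i) g (f i))).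
  apply: ler_sum => i Pi; rewrite /g /=.
  have [n kn] : exists n, k i = n.+1 by exists (k i).-1; rewrite prednK// k1.
  have /andP[a1 _] := kP i Pi; rewrite kn /= in a1 *.
  have -> : delta^-1 * (u n - u n.+1) = N * (u n * u n.+1).
    have a0 := u1 n; have b0 := u1 n.+1; rewrite -natr1 in b0.
    by rewrite /u -natr1; field; rewrite !gt_eqF.
  rewrite ler_wpM2l ?(ltW N0)// expr2 invfM.
  have t1 : 1 + N * (n.+1%:R * delta) <= 1 + N * t i.
    by rewrite lerD2l ler_wpM2l// ltW.
  have t0 : 0 < 1 + N * t i by exact: lt_le_trans (u1 _) t1.
  have t2 : (1 + N * t i)^-1 <= u n.+1 by rewrite lef_pV2// posrE.
  have t3 : 0 <= (1 + N * t i)^-1 by rewrite invr_ge0 ltW.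
  by apply: ler_pM => //; exact: le_trans t2 (udec n).
rewrite -(big_imset (fun x : 'I_M.+1 => g x) finj) /=.
apply: (@le_trans _ _ (\sum_(x < M.+1) g x)).
  rewrite [leRHS](bigID (mem (f @: P))) /= lerDl.
  by apply: sumr_ge0 => x _; rewrite mulr_ge0 ?invr_ge0 ?(ltW delta0)// subr_ge0.
rewrite -mulr_sumr -(big_mkord predT (fun n => u n - u n.+1)).
have -> : \sum_(0 <= n < M.+1) (u n - u n.+1) = u 0%N - u M.+1.
  by rewrite -opprB -telescope_sumr// -sumrN; apply: eq_bigr => n _; rewrite opprB.
rewrite ler_piMr ?invr_ge0 ?(ltW delta0)// /u mul0r mulr0 addr0 invr1.
by rewrite gerBl; exact: ltW (u0 M.+1).
Qed.

Lemma separated_sum (I : finType) (P : pred I) (t : I -> R) (delta N : R) :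
  0 < delta -> 0 < N -> (forall i, P i -> delta <= `|t i|) ->
  (forall i j, P i -> P j -> i != j -> delta <= `|t i - t j|) ->
  \sum_(i | P i) N / (1 + N * `|t i|) ^+ 2 <= 2 * delta^-1.
Proof.
move=> delta0 N0 tdelta tsep.
rewrite (bigID (fun i => 0 <= t i)) /= mulr_natl mulr2n lerD//.
  apply: (separated_sum_pos (t := fun i => `|t i|)) => //.
    by move=> i /andP[Pi _]; exact: tdelta.
  move=> i j /andP[Pi i0] /andP[Pj j0] ij.
  by rewrite (ger0_norm i0) (ger0_norm j0) tsep.
apply: (separated_sum_pos (t := fun i => `|t i|)) => //.
  by move=> i /andP[Pi _]; exact: tdelta.
move=> i j /andP[Pi i0] /andP[Pj j0] ij.
rewrite -ltNge in i0; rewrite -ltNge in j0.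
by rewrite (ltr0_norm i0) (ltr0_norm j0) opprK addrC distrC -normrN opprB tsep// eq_sym.
Qed.

Lemma dist_int_le (x : R) (a : int) : dist_int x <= `|x - a%:~R|.
Proof.
apply: ge_inf; last by exists a.
by exists 0 => _ [b _ <-].
Qed.

Section Frequencies.
Variable d : nat.

Definition freq q (u : {ffun 'I_d -> 'I_(2 * q).+1}) : 'rV[int]_d :=
  \row_i cint (u i).

Variables (alpha : 'rV[R]_d) (phi : R -> R).
Hypothesis phi_ge1 : forall x : R, 1 <= x -> 1 <= phi x.
Hypothesis phi_nd : forall x y : R, 1 <= x -> x <= y -> phi x <= phi y.
Hypothesis halpha : forall m : 'rV[int]_d, m != 0 ->
  1 / (height (intv R m) * phi (height (intv R m)))
    < dist_int (dotv (intv R m) alpha).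

Lemma dotvB (m n : 'rV[int]_d) :
  dotv (intv R (m - n)) alpha = dotv (intv R m) alpha - dotv (intv R n) alpha.
Proof.
rewrite /dotv -sumrB; apply: eq_bigr => i _.
by rewrite !mxE intrB mulrBl.
Qed.

Lemma height_ge1 (m : 'rV[R]_d) : 1 <= height m.
Proof.
rewrite /height; elim/big_ind: _ => // [x y x1 y1|i _].
  by rewrite -[1]mulr1 ler_pM.
by rewrite le_max lexx.
Qed.

Lemma dist_int_ge H (m : 'rV[int]_d) : m != 0 -> height (intv R m) <= H ->
  (H * phi H)^-1 <= dist_int (dotv (intv R m) alpha).
Proof.
move=> m0 mH; apply: le_trans (ltW (halpha m0)).
have m1 := height_ge1 (intv R m); have p1 := phi_ge1 m1.
have mp : 0 < height (intv R m) * phi (height (intv R m)).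
  by rewrite mulr_gt0// (lt_le_trans _ m1, lt_le_trans _ p1).
have le : height (intv R m) * phi (height (intv R m)) <= H * phi H.
  by apply: ler_pM => //; rewrite ?(le_trans _ m1) ?(le_trans _ p1)// phi_nd.
by rewrite div1r lef_pV2 ?posrE// (lt_le_trans mp).
Qed.

(** The differences of the frequencies in the box have height at most [H], so
the fractional parts of [m . alpha] are separated by [1 / (H * phi H)]. *)
Lemma box_sum q (M : 'I_d -> R) (H N : R) : 0 < N ->
  \prod_i Num.max 1 (2 * M i) <= H ->
  \sum_(u : {ffun 'I_d -> 'I_(2 * q).+1} |
         (freq u != 0) && [forall i, `|(cint (u i))%:~R| <= M i])
     N / (1 + N * `|sdist (dotv (intv R (freq u)) alpha)|) ^+ 2
    <= 2 * (H * phi H).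
Proof.
move=> N0 MH; rewrite -[H * phi H]invrK.
have H1 : 1 <= H.
  apply: le_trans MH; elim/big_ind: _ => // [x y x1 y1|i _].
    by rewrite -[1]mulr1 ler_pM.
  by rewrite le_max lexx.
have p1 := phi_ge1 H1.
have heightP (m : 'rV[int]_d) :
    (forall i, `|(m 0 i)%:~R| <= 2 * M i) -> height (intv R m) <= H.
  move=> mM; apply: le_trans MH; apply: ler_prod => i _.
  rewrite le_max ler01 /= mxE ge_max le_max lexx /= le_max.
  by rewrite mM orbT.
apply: separated_sum => //.
- by rewrite invr_gt0 mulr_gt0// (lt_le_trans _ H1, lt_le_trans _ p1).
- move=> u /andP[u0 /forallP uM].
  apply: (le_trans (dist_int_ge u0 _)); last exact: dist_int_le.
  apply: heightP => i; rewrite mxE; apply: (le_trans (uM i)).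
  by have := le_trans (normr_ge0 _) (uM i); lra.
move=> u v /andP[_ /forallP uM] /andP[_ /forallP vM] uv.
have uv0 : freq u - freq v != 0.
  rewrite subr_eq0; apply: contra uv => /eqP/rowP e; apply/eqP/ffunP => i.
  by apply: cint_inj; have := e i; rewrite !mxE.
apply: (@le_trans _ _ (dist_int (dotv (intv R (freq u - freq v)) alpha))).
  apply: dist_int_ge => //; apply: heightP => i; rewrite !mxE intrB.
  by apply: (le_trans (ler_normB _ _)); have := uM i; have := vM i; lra.
apply: (le_trans (dist_int_le _
  (nint (dotv (intv R (freq u)) alpha) - nint (dotv (intv R (freq v)) alpha)))).
rewrite dotvB /sdist intrB le_eqVlt; apply/orP; left; apply/eqP.
by congr `|_|; ring.
Qed.

End Frequencies.

(** Decay of order [A] is a superposition of indicators of dyadic intervals: at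
the least [j] with [x <= 2 ^ j], the [j]-th term alone already dominates. *)
Lemma dyadic_decay A J (x c w : R) : 0 <= x -> x <= 2 ^+ J -> 0 <= c ->
  w <= c -> w * x ^+ A <= c ->
  w <= \sum_(j < J.+1) c * 2 ^+ A * (2 ^- A) ^+ j * (x <= 2 ^+ j)%R%:R.
Proof.
move=> x0 xJ c0 wc wxc.
have ex : exists j, x <= 2 ^+ j by exists J.
have [j xj jmin] := ex_minnP ex.
have jJ : (j < J.+1)%N by rewrite ltnS jmin.
rewrite (bigD1 (Ordinal jJ)) //= xj mulr1 -[w]addr0 lerD//; last first.
  by apply: sumr_ge0 => i _; rewrite !mulr_ge0 ?exprn_ge0 ?invr_ge0 ?exprn_ge0.
case: j jmin {xj jJ} => [|j] jmin.
  by rewrite expr0 mulr1 (le_trans wc)// ler_peMr// exprn_ege1// ler1n.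
have xj : 2 ^+ j < x by rewrite ltNge; apply/negP => /jmin; rewrite ltnn.
have j0 : 0 < 2 ^+ j :> R by rewrite exprn_gt0.
have -> : c * 2 ^+ A * 2 ^- A ^+ j.+1 = c / (2 ^+ j) ^+ A.
  by rewrite exprS mulrA mulfK ?expf_neq0 ?pnatr_eq0// -!exprVn -!exprM mulnC.
rewrite ler_pdivlMr ?exprn_gt0//.
have [w0|w0] := leP w 0; last first.
  apply: le_trans wxc; rewrite ler_wpM2l ?(ltW w0)//.
  by apply: lerXn2r; rewrite ?nnegrE ?(ltW j0) ?(ltW xj).
by apply: le_trans c0; rewrite mulr_le0_ge0// exprn_ge0// ltW.
Qed.

End SeparatedSums.

(** * The total contribution of the nonzero frequencies *)

Section ErrorSum.
Variables (R : realType) (d : nat) (alpha : 'rV[R]_d) (phi : R -> R).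
Hypothesis phi_ge1 : forall x : R, 1 <= x -> 1 <= phi x.
Hypothesis phi_nd : forall x y : R, 1 <= x -> x <= y -> phi x <= phi y.
Hypothesis halpha : forall m : 'rV[int]_d, m != 0 ->
  1 / (height (intv R m) * phi (height (intv R m)))
    < dist_int (dotv (intv R m) alpha).
Variables (D eta : R) (A : nat).
Hypotheses (D0 : 0 <= D) (eta0 : 0 < eta) (etaA : 2 * eta < 2 ^+ A).
Hypothesis growth : forall n x, 1 <= x -> phi (2 ^+ n * x) <= D * eta ^+ n * phi x.

Lemma prod_natr_bool (I : finType) (B : I -> bool) :
  \prod_i (B i)%:R = [forall i, B i]%:R :> R.
Proof.
case: forallP => [BT|/forallP]; first by rewrite big1// => i _; rewrite BT.
rewrite negb_forall => /existsP[i /negbTE Bi].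
by rewrite (bigD1 i)//= Bi mul0r.
Qed.

Lemma geometric_sum_le (s : R) n : 0 <= s -> s < 1 ->
  \sum_(j < n) s ^+ j <= (1 - s)^-1.
Proof.
move=> s0 s1; have s1' : 0 < 1 - s by rewrite subr_gt0.
rewrite -[leRHS]mul1r ler_pdivlMr// mulrC -opprB mulNr -subrX1 opprB.
by rewrite gerBl exprn_ge0.
Qed.

(** By [box_sum], the dyadic box of index [j] contributes [O(H_j * phi H_j)], where
[H_j] is about [2 ^ |j| / P] with [P] the product of the [rho i].  Its weight, of
order [P * 2 ^ (- A |j|)], brings this down to [2 ^ (- (A - 1) |j|) * phi H_j],
which is dominated by a geometric series because [phi H_j] is
[O(eta ^ |j| * phi H0)] with [eta < 2 ^ (A - 1)]. *)
Lemma error_sum (C1 T1 : R) : 0 <= C1 -> 1 <= T1 ->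
  exists2 C, 0 <= C & forall (q : nat) (N H0 : R) (rho : 'I_d -> R)
    (b : 'I_d -> int -> R), 0 < N -> 1 <= H0 ->
  (forall i, 0 < rho i <= T1) -> H0^-1 <= \prod_i rho i ->
  (forall i m, 0 <= b i m) ->
  (forall i (m : int), `|m| <= q%:Z -> b i m <= C1 * rho i /\
     b i m * (rho i * `|m%:~R|) ^+ A <= C1 * rho i) ->
  \sum_(u : {ffun 'I_d -> 'I_(2 * q).+1} | freq u != 0)
     (\prod_i b i (cint (u i))) *
     (N / (1 + N * `|sdist (dotv (intv R (freq u)) alpha)|) ^+ 2) <= C * phi H0.
Proof.
move=> C10 T11.
have T10 : 0 < T1 by exact: lt_le_trans T11.
(* Boxes have volume up to [(2 * T1) ^ d * 2 ^ |j| / P]; the first factor is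
   absorbed in [n0] further doublings of [H0]. *)
pose n0 := (Num.trunc ((2 * T1) ^+ d)).+1.
have n0P : (2 * T1) ^+ d <= 2 ^+ n0.
  have /trunc_itv/andP[_ /ltW h] : 0 <= (2 * T1) ^+ d by rewrite exprn_ge0// mulr_ge0// ltW.
  by apply: (le_trans h); rewrite -natrX ler_nat ltnW// ltn_expl.
pose s := 2 * eta / 2 ^+ A.
have A0 : 0 < 2 ^+ A :> R by rewrite exprn_gt0.
have s0 : 0 <= s by rewrite divr_ge0 ?mulr_ge0// ltW.
have s1 : s < 1 by rewrite ltr_pdivrMr// mul1r.
pose E := C1 * 2 ^+ A * (2 * T1).
have E0 : 0 <= E by rewrite !mulr_ge0// ltW.
have s1V : 0 <= (1 - s)^-1 by rewrite invr_ge0 subr_ge0 ltW.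
exists (2 * (D * eta ^+ n0) * (E * (1 - s)^-1) ^+ d).
  by rewrite !mulr_ge0// exprn_ge0 ?mulr_ge0// ltW.
move=> q N H0 rho b N0 H01 rhoT rhoH b0 bq.
have rho0 i : 0 < rho i by have /andP[] := rhoT i.
have rho1 i : rho i <= T1 by have /andP[] := rhoT i.
have rhoV i : 0 < (rho i)^-1 by rewrite invr_gt0.
have phi0 : 0 <= phi H0 by rewrite (le_trans _ (phi_ge1 H01)).
set w := fun u : {ffun 'I_d -> 'I_(2 * q).+1} =>
  N / (1 + N * `|sdist (dotv (intv R (freq u)) alpha)|) ^+ 2.
have w0 u : 0 <= w u.
  by rewrite divr_ge0 ?exprn_ge0 ?addr_ge0 ?mulr_ge0// ltW.
(* Every dyadic scale met by a frequency of the window is at most [J]. *)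
pose J := (Num.trunc (T1 * q%:R)).+1.
have JP i (m : int) : `|m| <= q%:Z -> rho i * `|m%:~R| <= 2 ^+ J.
  move=> mq; apply: (@le_trans _ _ (T1 * q%:R)).
    by rewrite ler_pM ?(ltW (rho0 i))// -intr_norm pmulrn ler_int.
  have /trunc_itv/andP[_ /ltW h] : 0 <= T1 * q%:R by rewrite mulr_ge0// ltW.
  by apply: (le_trans h); rewrite -natrX ler_nat ltnW// ltn_expl.
pose kappa i (j : nat) := C1 * rho i * 2 ^+ A * (2 ^- A) ^+ j.
have kappa0 i j : 0 <= kappa i j.
  by rewrite !mulr_ge0 ?exprn_ge0 ?invr_ge0 ?(ltW A0)// ltW.
pose box (j : {ffun 'I_d -> 'I_J.+1}) (u : {ffun 'I_d -> 'I_(2 * q).+1}) :=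
  [forall i, `|(cint (u i))%:~R| <= 2 ^+ j i / rho i].
have decay (u : {ffun 'I_d -> 'I_(2 * q).+1}) : \prod_i b i (cint (u i)) <=
    \sum_(j : {ffun 'I_d -> 'I_J.+1}) (\prod_i kappa i (j i)) * (box j u)%:R.
  apply: (@le_trans _ _ (\prod_i \sum_(j < J.+1)
      kappa i j * (rho i * `|(cint (u i))%:~R| <= 2 ^+ j)%R%:R)).
    apply: ler_prod => i _; rewrite b0 /=.
    have uq := cint_le (u i); have [b1 b2] := bq i _ uq.
    by apply: dyadic_decay; rewrite ?JP// mulr_ge0// ltW.
  rewrite bigA_distr_bigA /= le_eqVlt; apply/orP; left; apply/eqP.
  apply: eq_bigr => j _; rewrite big_split /= prod_natr_bool; congr (_ * _%:R).
  by congr nat_of_bool; apply: eq_forallb => i; rewrite ler_pdivlMr// mulrC.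
apply: (@le_trans _ _ (\sum_(j : {ffun 'I_d -> 'I_J.+1})
    (\prod_i kappa i (j i)) * \sum_(u | (freq u != 0) && box j u) w u)).
  apply: (@le_trans _ _ (\sum_(u | freq u != 0) \sum_(j : {ffun 'I_d -> 'I_J.+1})
      (\prod_i kappa i (j i)) * (box j u)%:R * w u)).
    by apply: ler_sum => u _; rewrite -mulr_suml ler_wpM2r ?w0 ?decay.
  rewrite exchange_big /=; apply: ler_sum => j _.
  rewrite mulr_sumr big_mkcondr /=; apply: ler_sum => u _.
  by case: (box j u); rewrite ?mulr1// mulr0 mul0r.
have main (j : {ffun 'I_d -> 'I_J.+1}) :
    (\prod_i kappa i (j i)) * \sum_(u | (freq u != 0) && box j u) w u <=
    2 * (D * eta ^+ n0) * phi H0 * \prod_i (E * s ^+ j i).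
  set H := \prod_(i < d) (2 * T1 * (2 ^+ j i / rho i)).
  have jrho i : 0 < 2 ^+ j i / rho i by rewrite divr_gt0// exprn_gt0.
  have bs := @box_sum R d alpha phi phi_ge1 phi_nd halpha q
    (fun i => 2 ^+ j i / rho i) H N N0.
  have H_ge : \prod_(i < d) Num.max 1 (2 * (2 ^+ j i / rho i)) <= H.
    apply: ler_prod => i _; rewrite le_max ler01 /= ge_max; apply/andP; split.
      rewrite mulrA ler_pdivlMr// mul1r (le_trans (rho1 i))//.
      rewrite -mulrA mulrCA ler_peMr ?(ltW T10)//.
      by rewrite -exprS exprn_ege1// ler1n.
    by rewrite ler_wpM2r ?(ltW (jrho i))// ler_peMr.
  have H1 : 1 <= H.
    apply: le_trans H_ge; elim/big_ind: _ => // [x y x1 y1|i _].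
      by rewrite -[1]mulr1 ler_pM.
    by rewrite le_max lexx.
  have k0 : 0 <= \prod_i kappa i (j i) by apply: prodr_ge0.
  apply: (le_trans (ler_wpM2l k0 (bs H_ge))).
  have HE : H = (2 * T1) ^+ d * 2 ^+ (\sum_i j i)%N * (\prod_i rho i)^-1.
    rewrite /H big_split /= prodr_const card_ord -mulrA; congr (_ * _).
    by rewrite big_split /= prodfV expr_sum.
  have phiH : phi H <= D * eta ^+ n0 * (\prod_i eta ^+ j i) * phi H0.
    apply: (@le_trans _ _ (phi (2 ^+ (n0 + \sum_i j i)%N * H0))).
      apply: phi_nd => //; rewrite HE exprD.
      have P0 : 0 < \prod_i rho i by apply: prodr_gt0.
      apply: ler_pM; rewrite ?mulr_ge0 ?exprn_ge0 ?mulr_ge0 ?invr_ge0 ?(ltW P0) ?(ltW T10)//.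
        by rewrite ler_wpM2r// exprn_ge0.
      by rewrite -[leRHS]invrK lef_pV2// posrE invr_gt0 (lt_le_trans _ H01).
    apply: (le_trans (growth _ H01)).
    by rewrite exprD mulrA expr_sum.
  have -> : \prod_i kappa i (j i) * (2 * (H * phi H)) =
      2 * (\prod_i (E * (2 / 2 ^+ A) ^+ j i)) * phi H.
    have -> : \prod_(i < d) (E * (2 / 2 ^+ A) ^+ j i) = \prod_i kappa i (j i) * H.
      rewrite /H -big_split /=; apply: eq_bigr => i _.
      rewrite /kappa /E expr_div_n exprVn; field.
      by rewrite !gt_eqF ?exprn_gt0.
    by ring.
  have X0 : 0 <= 2 * \prod_i (E * (2 / 2 ^+ A) ^+ j i).
    rewrite mulr_ge0//; apply: prodr_ge0 => i _.
    by rewrite mulr_ge0// exprn_ge0// divr_ge0// ltW.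
  apply: (le_trans (ler_wpM2l X0 phiH)); rewrite le_eqVlt; apply/orP; left; apply/eqP.
  have -> : \prod_(i < d) (E * s ^+ j i) =
      (\prod_i (E * (2 / 2 ^+ A) ^+ j i)) * \prod_i eta ^+ j i.
    rewrite -big_split /=; apply: eq_bigr => i _.
    by rewrite -[RHS]mulrA -exprMn /s; congr (_ * _ ^+ _); exact: mulrAC.
  by ring.
apply: (@le_trans _ _ (\sum_(j : {ffun 'I_d -> 'I_J.+1})
    2 * (D * eta ^+ n0) * phi H0 * \prod_i (E * s ^+ j i))).
  by apply: ler_sum => j _; exact: main.
rewrite -mulr_sumr -(bigA_distr_bigA (fun i (k : 'I_J.+1) => E * s ^+ k)) /=.
rewrite prodr_const card_ord [leRHS]mulrAC ler_wpM2l//.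
  by rewrite !mulr_ge0// exprn_ge0// ltW.
apply: lerXn2r; rewrite ?nnegrE ?(mulr_ge0 E0 s1V)//.
  by apply: sumr_ge0 => k _; rewrite mulr_ge0// exprn_ge0.
by rewrite -mulr_sumr ler_wpM2l// geometric_sum_le.
Qed.

End ErrorSum.

(** * Counting lattice points in large boxes *)

Section LatticePointCount.
Variable R : realType.

Lemma prod_perturbation (I : finType) (x y : I -> R[i]) (B e : R) :
  0 <= B -> 0 <= e <= 1 -> (forall i, cabs (x i) <= B) ->
  (forall i, cabs (x i - y i) <= e) ->
  cabs (\prod_i x i - \prod_i y i) <= e * (#|I|%:R * (B + 1) ^+ #|I|).
Proof.
move=> B0 /andP[e0 e1] xB xy.
have yB i : cabs (y i) <= B + 1.
  have -> : y i = x i - (x i - y i) by rewrite opprB addrC subrK.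
  by rewrite (le_trans (cabsB _ _))// lerD// (le_trans (xy i)).
have B1 : 1 <= B + 1 by rewrite lerDr.
have -> : #|I| = size (index_enum I) by rewrite cardT enumT.
elim: (index_enum I) => [|i s IHs].
  by rewrite !big_nil subrr cabs0 mul0r mulr0.
rewrite !big_cons /=; set X := \prod_(j <- s) x j in IHs *.
set Y := \prod_(j <- s) y j in IHs *; set n := size s in IHs *.
have -> : x i * X - y i * Y = x i * (X - Y) + (x i - y i) * Y by ring.
have Y1 : cabs Y <= (B + 1) ^+ n.
  rewrite /Y /n; elim: (s) => [|j s' IHs']; first by rewrite big_nil cabs1.
  by rewrite big_cons cabsM /= exprS ler_pM ?cabs_ge0.
apply: (le_trans (cabsD _ _)); rewrite !cabsM.
have Z0 : 0 <= (B + 1) ^+ n by rewrite exprn_ge0// (le_trans ler01).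
have h1 : cabs (x i) * cabs (X - Y) <= (B + 1) * (e * (n%:R * (B + 1) ^+ n)).
  by apply: ler_pM; rewrite ?cabs_ge0// (le_trans (xB i))// lerDl.
have h2 : cabs (x i - y i) * cabs Y <= e * ((B + 1) * (B + 1) ^+ n).
  apply: ler_pM; rewrite ?cabs_ge0// (le_trans Y1)//.
  by rewrite ler_peMl.
apply: (le_trans (lerD h1 h2)).
by rewrite -natr1 exprS le_eqVlt; apply/orP; left; apply/eqP; ring.
Qed.

Lemma le_perturbation (x y M : R) : 0 <= M ->
  (forall e, 0 < e -> e <= 1 -> x <= y + e * M) -> x <= y.
Proof.
move=> M0 H; apply/ler_addgt0Pr => e e0.
pose e' := Num.min 1 (e / (M + 1)).
have M1 : 0 < M + 1 by rewrite ltr_wpDl.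
apply: (le_trans (H e' _ _)).
- by rewrite lt_min ltr01 divr_gt0.
- by rewrite ge_min lexx.
rewrite lerD2l (@le_trans _ _ (e / (M + 1) * M))//.
  by rewrite ler_wpM2r// ge_min lexx orbT.
by rewrite mulrAC ler_pdivrMr// ler_wpM2l ?(ltW e0)// lerDl.
Qed.

(** Summation by parts with step [1 / N], with the decay put in the form that is
summed in [separated_sum]. *)
Lemma phase_sum_bound A T f : (2 <= A)%N -> 0 <= T -> smooth_bump A T f ->
  exists2 C, 0 <= C & forall (N : R) V theta, 1 <= N -> T * N <= V%:R ->
    cabs (isum V (fun a => (f (a%:~R / N))%:C * echar (a%:~R * theta)))
      <= C * (N / (1 + N * `|sdist theta|) ^+ 2).
Proof.
move=> A2 T0 [fT [B [fB _ dfB]]].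
have [C C0 HC] := exp_sum_bound T0 fB dfB fT.
exists (4 * C) => [|N V theta N1 TV]; first by rewrite mulr_ge0.
have N0 : 0 < N by exact: lt_le_trans N1.
have hN : 0 < N^-1 <= 1 by rewrite invr_gt0 N0 invf_le1.
have TVh : T <= V%:R * N^-1 by rewrite ler_pdivlMr.
have [] := HC _ theta V (nint theta) hN TVh (sdist_le theta).
rewrite -/(sdist theta) invrK; set S := cabs _ => S1 S2.
set x := N * `|sdist theta|; rewrite [`|_| * N]mulrC -/x in S2.
have x0 : 0 <= x by rewrite mulr_ge0// ltW.
have x1 : 0 < (1 + x) ^+ 2 by rewrite exprn_gt0// ltr_wpDr.
rewrite mulrA ler_pdivlMr// -ler_pdivrMr// mulrAC.
have SN0 : 0 <= S / N by rewrite divr_ge0 ?cabs_ge0// ltW.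
have [x_le1|x_gt1] := leP x 1.
  rewrite mulrC; apply: ler_pM => //; first by rewrite ltW.
  have -> : 4 = (1 + 1) ^+ 2 :> R by rewrite expr2; ring.
  by apply: lerXn2r; rewrite ?nnegrE ?addr_ge0// lerD2l.
have xA : (1 + x) ^+ 2 <= 4 * x ^+ A.
  apply: (@le_trans _ _ (4 * x ^+ 2)); last by rewrite ler_wpM2l// ler_weXn2l// ltW.
  have -> : 4 * x ^+ 2 = (x + x) ^+ 2 by ring.
  by apply: lerXn2r; rewrite ?nnegrE ?addr_ge0// lerD2r ltW.
apply: (le_trans (ler_wpM2l SN0 xA)).
by rewrite mulrCA ler_wpM2l.
Qed.

Variables (d : nat) (alpha : 'rV[R]_d).

(** The last coordinate has a window of its own, because the window [K] of the
others has to exceed [V * |alpha 0 i|], which may be larger than [V]. *)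
Definition count_sum (V K : nat) (om : 'I_d -> R -> R) (omk : R -> R)
    (gamma rho : 'I_d -> R) (N : R) : R :=
  isum V (fun a => omk (a%:~R / N) *
    \prod_i isum K (fun b => om i ((b%:~R + (a%:~R * alpha 0 i - gamma i)) / rho i))).

Lemma freq_eq0 q (u : {ffun 'I_d -> 'I_(2 * q).+1}) :
  (freq u == 0) = [forall i, cint (u i) == 0].
Proof.
apply/eqP/forallP => [/rowP e i|e]; first by have := e i; rewrite !mxE => ->.
by apply/rowP => i; rewrite !mxE; apply/eqP.
Qed.

Lemma trig_product_expansion (V q : nat) (c : 'I_d -> int -> R[i]) (g : int -> R[i])
    (gamma : 'I_d -> R) :
  isum V (fun a => g a *
    \prod_i isum q (fun m => c i m * echar (m%:~R * (a%:~R * alpha 0 i - gamma i))))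
  = \sum_(u : {ffun 'I_d -> 'I_(2 * q).+1})
      (\prod_i (c i (cint (u i)) * echar (- (cint (u i))%:~R * gamma i))) *
      isum V (fun a => g a * echar (a%:~R * dotv (intv R (freq u)) alpha)).
Proof.
under [RHS]eq_bigr do rewrite isum_distrr.
rewrite [RHS]exchange_big /=; apply: eq_bigr => k _; set a := cint k.
rewrite /isum bigA_distr_bigA mulr_sumr; apply: eq_bigr => u _.
rewrite mulrCA; congr (_ * _).
have -> : a%:~R * dotv (intv R (freq u)) alpha =
    \sum_i (cint (u i))%:~R * (a%:~R * alpha 0 i) :> R.
  by rewrite /dotv mulr_sumr; apply: eq_bigr => i _; rewrite !mxE mulrCA.
rewrite echar_sum -big_split /=; apply: eq_bigr => i _.
by rewrite -mulrA -echarD; congr (_ * echar _); ring.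
Qed.

Variable phi : R -> R.
Hypothesis phi_ge1 : forall x : R, 1 <= x -> 1 <= phi x.
Hypothesis phi_nd : forall x y : R, 1 <= x -> x <= y -> phi x <= phi y.
Hypothesis halpha : forall m : 'rV[int]_d, m != 0 ->
  1 / (height (intv R m) * phi (height (intv R m)))
    < dist_int (dotv (intv R m) alpha).
Variables (D eta : R) (A : nat).
Hypotheses (D0 : 0 <= D) (eta0 : 0 < eta) (etaA : 2 * eta < 2 ^+ A).
Hypothesis growth : forall n x, 1 <= x -> phi (2 ^+ n * x) <= D * eta ^+ n * phi x.
Hypothesis A3 : (3 <= A)%N.

Notation integral f := (Rintegral lebesgue_measure setT f).

(** Replacing each periodised weight by a trigonometric polynomial turns the
count into a sum over frequencies.  Frequency 0 gives the main term up to the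
error of a Riemann sum for [omk]; the others are controlled by [error_sum],
because the sum over [a] is small unless [m . alpha] is close to an integer. *)
Lemma count_sum_asymptotic (T T1 : R) (om : 'I_d -> R -> R) (omk : R -> R) :
  0 <= T -> 1 <= T1 -> (forall i, smooth_bump A T (om i)) -> smooth_bump A T omk ->
  exists2 C, 0 <= C & forall (N H0 : R) (gamma rho : 'I_d -> R) (V K : nat),
    1 <= N -> 1 <= H0 -> (forall i, 0 < rho i <= T1) -> H0^-1 <= \prod_i rho i ->
    T * N <= V%:R ->
    (forall i, T * rho i + (V%:R * `|alpha 0 i| + `|gamma i|) + 1 <= K%:R) ->
    `|count_sum V K om omk gamma rho N
      - (\prod_i (rho i * integral (om i))) * (N * integral omk)| <= C * phi H0.
Proof.
move=> T0 T11 omb omkb.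
have T10 : 0 < T1 by exact: lt_le_trans T11.
have [Cp /= Cp0 HCp] := fin_all_exists2 (fun i => periodization_approx A3 T0 (omb i)).
have [Ck Ck0 HCk] := phase_sum_bound (ltnW A3) T0 omkb.
pose C1 := \sum_i Cp i.
have C10 : 0 <= C1 by apply: sumr_ge0 => i _; exact: Cp0.
have CpC i : Cp i <= C1.
  by rewrite /C1 (bigD1 i)//= lerDl; apply: sumr_ge0 => j _; exact: Cp0.
have [Ce Ce0 HCe] := error_sum phi_ge1 phi_nd halpha D0 eta0 etaA growth C10 T11.
have bdd i : exists B, 0 <= B /\ forall x, `|om i x| <= B.
  by have [_ [B [fB _ _]]] := omb i; exists B; split=> //; exact: le_trans (fB 0).
have [Bi HBi] := fin_all_exists bdd.
pose B := \sum_i Bi i.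
have B0 : 0 <= B by apply: sumr_ge0 => i _; have [] := HBi i.
have omB i x : `|om i x| <= B.
  have [_ /(_ x)/le_trans] := HBi i; apply; rewrite /B (bigD1 i)//= lerDl.
  by apply: sumr_ge0 => j _; have [] := HBi j.
case: omkb => omkT [Bk [omkB [domk domkB] _]].
have Bk0 : 0 <= Bk by exact: le_trans (normr_ge0 _) (omkB 0).
have fdf x : is_derive x (1 : R) omk (derive1 omk x).
  by rewrite derive1E; exact/derivableP.
pose Cr := (2 * T + 3) * Bk.
have Cr0 : 0 <= Cr by rewrite mulr_ge0// addr_ge0// mulr_ge0.
pose BI := T1 * \sum_i `|integral (om i)|.
have BI0 : 0 <= BI by rewrite mulr_ge0 ?(ltW T10)//; apply: sumr_ge0.
exists (Ck * Ce + BI ^+ d * Cr).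
  by rewrite addr_ge0//; apply: mulr_ge0 => //; exact: exprn_ge0.
move=> N H0 gamma rho V K N1 H01 rhoT rhoH TV TK.
have rho0 i : 0 < rho i by have /andP[] := rhoT i.
have rho1 i : rho i <= T1 by have /andP[] := rhoT i.
have N0 : 0 < N by exact: lt_le_trans N1.
have phi0 : 1 <= phi H0 by exact: phi_ge1.
have rI i : `|rho i * integral (om i)| <= BI.
  rewrite normrM ger0_norm ?(ltW (rho0 i))// ler_pM ?(ltW (rho0 i))//.
  by rewrite (bigD1 i)//= lerDl; exact: sumr_ge0.
pose BF := (2 * K).+1%:R * B.
have BF0 : 0 <= BF by rewrite mulr_ge0.
pose M1 := (2 * V).+1%:R * (Bk * (d%:R * (BF + 1) ^+ d)).
pose M2 := d%:R * (BI + 1) ^+ d * (Ck * N).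
have M10 : 0 <= M1.
  by rewrite !mulr_ge0 ?exprn_ge0 ?addr_ge0.
have M20 : 0 <= M2 by rewrite !mulr_ge0 ?exprn_ge0 ?addr_ge0// ltW.
(* From here on [e] is the accuracy of the trigonometric approximation; all
   other quantities, including the windows, stay fixed as it tends to 0. *)
apply: (le_perturbation (M := M1 + M2)); first by rewrite addr_ge0.
move=> e e0 e1.
have Y0 i : 0 <= V%:R * `|alpha 0 i| + `|gamma i| by rewrite addr_ge0// mulr_ge0.
have [q0 Hq0] := fin_all_exists (fun i =>
  HCp i (rho i) (V%:R * `|alpha 0 i| + `|gamma i|) K e (rho0 i) (Y0 i) e0 (TK i)).
pose q := (\max_i q0 i)%N.
have [c Hc] := fin_all_exists (fun i => Hq0 i q (leq_bigmax i)).
pose y i (a : int) : R := a%:~R * alpha 0 i - gamma i.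
pose F i a := isum K (fun b => om i ((b%:~R + y i a) / rho i)).
pose P i a : R[i] := isum q (fun m => c i m * echar (m%:~R * y i a)).
pose S' : R[i] := isum V (fun a => (omk (a%:~R / N))%:C * \prod_i P i a).
set E := fun theta : R =>
  isum V (fun a => (omk (a%:~R / N))%:C * echar (a%:~R * theta)) : R[i].
set S := count_sum _ _ _ _ _ _ _.
have Fapprox i a : `|a| <= V%:Z -> cabs ((F i a)%:C - P i a) <= e.
  move=> aV; have [_ _] := Hc i; apply.
  rewrite (le_trans (ler_normB _ _))// lerD2r normrM ler_wpM2r//.
  by rewrite -intr_norm pmulrn ler_int.
have FB i a : cabs (F i a)%:C <= BF.
  rewrite cabs_real (le_trans (ler_norm_sum _ _ _))//.
  by apply: (isum_le_const (F := fun b => `|om i ((b%:~R + y i a) / rho i)|)).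
have SS' : cabs (S%:C - S') <= e * M1.
  rewrite /S /count_sum -isum_real /S' /isum -sumrB (le_trans (cabs_sum _ _ _))//.
  have step a : `|a| <= V%:Z ->
      cabs ((omk (a%:~R / N) * \prod_i F i a)%:C - (omk (a%:~R / N))%:C * \prod_i P i a)
      <= Bk * (e * (d%:R * (BF + 1) ^+ d)).
    move=> aV; rewrite rmorphM rmorph_prod /= -mulrBr cabsM.
    apply: ler_pM; rewrite ?cabs_ge0//; first by rewrite cabs_real.
    have e01 : 0 <= e <= 1 by rewrite (ltW e0).
    have := prod_perturbation BF0 e01
      (fun i => FB i a) (fun i => Fapprox i a aV).
    by rewrite card_ord.
  apply: (le_trans (isum_le_const (F := fun a =>
    cabs ((omk (a%:~R / N) * \prod_i F i a)%:C - (omk (a%:~R / N))%:C * \prod_i P i a)) step)).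
  by rewrite /M1 le_eqVlt; apply/orP; left; apply/eqP; ring.
have S'E : S' = \sum_(u : {ffun 'I_d -> 'I_(2 * q).+1})
   (\prod_i (c i (cint (u i)) * echar (- (cint (u i))%:~R * gamma i))) *
      E (dotv (intv R (freq u)) alpha).
  exact: trig_product_expansion.
have [i0 i0E] : exists i, @cint q i = 0 by apply: cint_surj; rewrite normr0.
pose u0 : {ffun 'I_d -> 'I_(2 * q).+1} := [ffun=> i0].
have u0P u : (freq u == 0) = (u == u0).
  rewrite freq_eq0; apply/forallP/eqP => [e'|->] .
    by apply/ffunP => i; rewrite ffunE; apply: cint_inj; rewrite i0E; apply/eqP.
  by move=> i; rewrite ffunE i0E.
pose G (u : {ffun 'I_d -> 'I_(2 * q).+1}) := (\prod_i (c i (cint (u i)) * echar (- (cint (u i))%:~R * gamma i))) *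
      E (dotv (intv R (freq u)) alpha).
have S'E2 : S' = (\prod_i c i 0) * E 0 + \sum_(u | freq u != 0) G u.
  rewrite S'E (bigID (fun u => freq u == 0)) /=; congr (_ + _).
  rewrite (big_pred1 u0) => [|u]; last exact: u0P.
  congr (_ * E _).
    by apply: eq_bigr => i _; rewrite ffunE i0E oppr0 mul0r echar0 mulr1.
  rewrite /dotv big1// => i _.
  have /eqP -> : freq u0 == 0 by rewrite u0P.
  by rewrite !mxE mul0r.
have EN theta : cabs (E theta) <= Ck * (N / (1 + N * `|sdist theta|) ^+ 2).
  exact: HCk.
have err : cabs (\sum_(u | freq u != 0) G u) <= Ck * Ce * phi H0.
  apply: (le_trans (cabs_sum _ _ _)).
  apply: (@le_trans _ _ (\sum_(u | freq u != 0) Ck * ((\prod_i cabs (c i (cint (u i)))) *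
     (N / (1 + N * `|sdist (dotv (intv R (freq u)) alpha)|) ^+ 2)))).
    apply: ler_sum => u _; rewrite /G cabsM cabs_prod mulrCA.
    have -> : \prod_i cabs (c i (cint (u i)) * echar (- (cint (u i))%:~R * gamma i)) =
        \prod_i cabs (c i (cint (u i))).
      by apply: eq_bigr => i _; rewrite cabsM cabs_echar mulr1.
    rewrite ler_wpM2l ?EN//.
    by apply: prodr_ge0 => i _; exact: cabs_ge0.
  rewrite -mulr_sumr -mulrA ler_wpM2l//.
  apply: (HCe q N H0 rho (fun i m => cabs (c i m))) => //.
    by move=> i m; exact: cabs_ge0.
  move=> i m mq; have [/(_ m mq)[h1 h2] _ _] := Hc i.
  have h3 : Cp i * rho i <= C1 * rho i by rewrite ler_wpM2r// ltW.
  by split; [exact: le_trans h1 h3|exact: le_trans h2 h3].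
have N1h : 0 < N^-1 <= 1 by rewrite invr_gt0 N0 invf_le1.
have TVh : T <= V%:R * N^-1 by rewrite ler_pdivlMr.
have E0 : cabs (E 0 - (N * integral omk)%:C) <= Cr.
  have -> : E 0 = (isum V (fun a => omk (a%:~R / N)))%:C.
    rewrite -isum_real; apply: eq_isum => a _.
    by rewrite mulr0 echar0 mulr1.
  rewrite -rmorphB cabs_real /=.
  have := riemann_sum T0 omkT fdf domkB N1h TVh.
  set X := isum _ _; have -> : X - N * integral omk = N * (N^-1 * X - integral omk).
    by rewrite mulrBr mulrA mulfV ?gt_eqF// mul1r.
  by move=> rs; rewrite normrM (gtr0_norm N0) mulrC -ler_pdivlMr.
have EN0 : cabs (E 0) <= Ck * N.
  apply: (le_trans (EN 0)); rewrite ler_wpM2l// ler_pdivrMr.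
    by rewrite ler_peMr ?(ltW N0)// exprn_ege1// lerDl mulr_ge0// ltW//.
  by rewrite exprn_gt0// ltr_wpDr// mulr_ge0// ltW.
have main : cabs ((\prod_i c i 0) * E 0
    - ((\prod_i (rho i * integral (om i))) * (N * integral omk))%:C)
    <= e * M2 + BI ^+ d * Cr.
  rewrite rmorphM rmorph_prod /=.
  set X := \prod_i c i 0; set Z := \prod_i (rho i * _)%:C.
  set z := (N * integral omk)%:C in E0 *.
  have -> : X * E 0 - Z * z = (X - Z) * E 0 + Z * (E 0 - z) by ring.
  apply: (le_trans (cabsD _ _)); rewrite !cabsM lerD//.
    rewrite /M2 mulrA ler_pM ?cabs_ge0//.
    have e01 : 0 <= e <= 1 by rewrite (ltW e0).
    have := prod_perturbation
      (x := fun i => (rho i * integral (om i))%:C) (y := fun i => c i 0) BI0 e01.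
    rewrite card_ord -/Z -/X => H.
    rewrite -cabsN opprB; apply: H => i; first by rewrite cabs_real.
    by rewrite -cabsN opprB; have [] := Hc i.
  apply: ler_pM; rewrite ?cabs_ge0// /Z cabs_prod.
  rewrite -[X in _ ^+ X]card_ord -prodr_const.
  by apply: ler_prod => i _; rewrite cabs_ge0 cabs_real rI.
rewrite -cabs_real rmorphB.
set Y := (_ * _)%:C in main *.
have -> : S%:C - Y = (S%:C - S') + ((\prod_i c i 0) * E 0 - Y)
    + \sum_(u | freq u != 0) G u by rewrite S'E2; ring.
apply: (le_trans (cabsD _ _)); apply: (le_trans (lerD (cabsD _ _) (lexx _))).
have BC : BI ^+ d * Cr <= BI ^+ d * Cr * phi H0.
  by rewrite ler_peMr// mulr_ge0// exprn_ge0.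
by rewrite mulrDl mulrDr; lra.
Qed.

End LatticePointCount.

(** * Growth of phi and smoothness of the weights *)

Section DoublingGrowth.
Variables (R : realType) (phi : R -> R) (xi : R).
Hypothesis phi_ge1 : forall x : R, 1 <= x -> 1 <= phi x.
Hypothesis phi_nd : forall x y : R, 1 <= x -> x <= y -> phi x <= phi y.
Hypothesis hxi : limf_esup (fun x : R => (phi (2 * x) / phi x)%:E) (pinfty_nbhs R)
           = xi%:E.

Lemma limsup_doubling_ge1 : 1 <= xi.
Proof.
rewrite -lee_fin -hxi limf_esupE; apply: le_ereal_inf_tmp => _ [V [M [_ MV]] <-].
pose x := Num.max 1 (M + 1).
have x1 : 1 <= x by rewrite le_max lexx.
have Vx : V x by apply: MV; rewrite lt_max ltrDl ltr01 orbT.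
apply: (@le_trans _ _ (phi (2 * x) / phi x)%:E); last first.
  by apply: ereal_sup_ubound; exists x.
have p0 : 0 < phi x by rewrite (lt_le_trans _ (phi_ge1 x1)).
by rewrite lee_fin ler_pdivlMr// mul1r phi_nd//; lra.
Qed.

(** Beyond some [X] each doubling costs at most a factor [eta]; below [X], the
argument is first moved up to [X], which costs a factor [phi X]. *)
Lemma doubling_growth (eta : R) : xi < eta -> exists2 D, 0 <= D &
  forall n x, 1 <= x -> phi (2 ^+ n * x) <= D * eta ^+ n * phi x.
Proof.
move=> xieta; have eta0 : 0 < eta.
  by apply: lt_trans xieta; rewrite (lt_le_trans _ limsup_doubling_ge1).
have : (limf_esup (fun x : R => (phi (2 * x) / phi x)%:E) (pinfty_nbhs R) < eta%:E)%E.
  by rewrite hxi lte_fin.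
rewrite limf_esupE => /ereal_inf_lt[_ [V [M [_ MV]] <-] Veta].
pose X := Num.max 1 (M + 1).
have X1 : 1 <= X by rewrite le_max lexx.
have step x : X <= x -> phi (2 * x) <= eta * phi x.
  move=> Xx; have Vx : V x.
    by apply: MV; rewrite (lt_le_trans _ Xx)// lt_max ltrDl ltr01 orbT.
  have p0 : 0 < phi x by rewrite (lt_le_trans _ (phi_ge1 (le_trans X1 Xx))).
  rewrite -ler_pdivrMr// -lee_fin; apply: ltW; apply: le_lt_trans Veta.
  by apply: ereal_sup_ubound; exists x.
have pX0 : 0 <= phi X by rewrite (le_trans _ (phi_ge1 X1)).
exists (phi X) => // n x x1.
pose x' := Num.max x X.
have xx' : x <= x' by rewrite le_max lexx.
have x'1 : 1 <= x' by exact: le_trans xx'.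
have n1 k : 1 <= 2 ^+ k :> R by rewrite exprn_ege1// ler1n.
have iter k : phi (2 ^+ k * x') <= eta ^+ k * phi x'.
  elim: k => [|k IHk]; first by rewrite !mul1r.
  rewrite !exprS -!mulrA (le_trans (step _ _))//.
    apply: (@le_trans _ _ x'); first by rewrite le_max lexx orbT.
    by rewrite ler_peMl// (le_trans _ x'1).
  by rewrite ler_wpM2l// ltW.
apply: (@le_trans _ _ (phi (2 ^+ n * x'))).
  apply: phi_nd; first by rewrite mulr_ege1.
  by rewrite ler_wpM2l// exprn_ge0.
apply: (le_trans (iter n)); rewrite mulrAC -[leRHS]mulrC ler_wpM2l ?exprn_ge0 ?(ltW eta0)//.
rewrite /x'; have [Xx|xX] := leP X x.
  by rewrite ler_peMl ?phi_ge1// (le_trans _ (phi_ge1 x1)).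
by rewrite ler_peMr ?phi_ge1.
Qed.

(** With [t = log xi / log 2 >= 0], the hypothesis [2 + 2 * t < l] gives both
[2 < l] and [1 + t < l], and the latter says that [2 * xi < 2 ^ l]. *)
Lemma growth_rate (l : nat) : 2 + 2 * (ln xi / ln 2) < l%:R ->
  (3 <= l)%N /\ exists2 eta, xi < eta & 2 * eta < 2 ^+ l.
Proof.
move=> hl; have xi1 := limsup_doubling_ge1.
have ln2 : 0 < ln 2 :> R by rewrite ln_gt0 ?ltr1n.
have t0 : 0 <= ln xi / ln 2 by apply: divr_ge0; [exact: ln_ge0|exact: ltW].
split; first by rewrite -(ltr_nat R); lra.
have h : 2 * xi < 2 ^+ l.
  have xi0 : 0 < xi by exact: lt_le_trans xi1.
  rewrite -ltr_ln ?posrE ?mulr_gt0 ?exprn_gt0// lnM ?posrE// lnXn//.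
  have : (1 + ln xi / ln 2) * ln 2 < l%:R * ln 2 by rewrite ltr_pM2r//; lra.
  by rewrite mulrDl mul1r divfK ?gt_eqF// mulr_natl.
exists ((xi + 2 ^+ l / 2) / 2); lra.
Qed.

End DoublingGrowth.

Section SmoothWeights.
Variable R : realType.
Implicit Types (f : R -> R) (T : R).

Lemma supported_derive1 T f : supported T f -> supported T (derive1 f).
Proof.
move=> fT x xT; rewrite derive1E (@near_eq_derive _ _ _ _ (cst 0))//.
  by rewrite derive_cst.
near=> y; rewrite fT//=.
near: y.
have op : open [set y : R | T < `|y|].
  apply: (@open_comp _ _ (fun y : R => `|y|) [set y | T < y]).
    by move=> y _; exact: norm_continuous.
  exact: open_gt.
by apply: open_nbhs_nbhs; split.
Unshelve. all: by end_near. Qed.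

Lemma supported_bounded T f : continuous f -> supported T f ->
  exists B, forall x, `|f x| <= B.
Proof.
move=> cf fT; have T0 : - `|T| <= `|T| by rewrite ge0_cp.
have cnf : {within `[- `|T|, `|T|], continuous (fun x => `|f x|)}.
  apply: continuous_subspaceT => x; apply: continuous_comp; first exact: cf.
  exact: norm_continuous.
have [c _ cmax] := EVT_max T0 cnf.
exists `|f c| => x; have [xT|xT] := leP `|x| `|T|.
  by apply: cmax; rewrite in_itv /= -ler_norml.
by rewrite fT ?normr0// (le_lt_trans (ler_norm _) xT).
Qed.

Lemma deriv_bounded_le A f B B' : B <= B' -> deriv_bounded A f B -> deriv_bounded A f B'.
Proof.
move=> BB'; elim: A f => [|A IHA] f /=; first by move=> fB x; exact: le_trans BB'.
by move=> [df dB]; split=> //; exact: IHA.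
Qed.

Lemma contdiff_smooth_bump l T f : (2 <= l)%N -> contdiff l f -> supported T f ->
  smooth_bump l T f.
Proof.
move=> l2 [df cfl] fT; split=> //.
have sT j : supported T (derive1n j f).
  by elim: j => [//|j IHj]; rewrite derive1nS; exact: supported_derive1.
have cj j : (j < l)%N -> continuous (derive1n j f).
  by move=> jl x; apply/differentiable_continuous/derivable1_diffP; exact: df.
have [B0 HB0] := supported_bounded (cj 0%N (ltnW l2)) (sT 0%N).
have [B1 HB1] := supported_bounded (cj 1%N l2) (sT 1%N).
have [Bl HBl] := supported_bounded cfl (sT l).
have b0 := le_trans (normr_ge0 _) (HB0 0).
have b1 := le_trans (normr_ge0 _) (HB1 0).
have bl := le_trans (normr_ge0 _) (HBl 0).
exists (B0 + B1 + Bl); split.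
- by move=> x; apply: (le_trans (HB0 x)); lra.
- split; first by move=> x; exact: (df 0%N x (ltnW l2)).
  by move=> x; apply: (le_trans (HB1 x)); lra.
apply: (@deriv_bounded_le _ _ Bl); first by lra.
suff H k j : (k + j = l)%N -> deriv_bounded k (derive1n j f) Bl.
  by apply: (H l 0%N); rewrite addn0.
elim: k j => [|k IHk] j; first by rewrite add0n => ->.
move=> kj; split; first by move=> x; apply: df; rewrite -kj addSn ltnS leq_addl.
by rewrite -derive1nS; apply: IHk; rewrite addnS -addSn.
Qed.

Lemma fourier0 f : fourier f 0 = (Rintegral lebesgue_measure setT f)%:C.
Proof.
rewrite /fourier /cintegral; apply/eqP; rewrite eq_complex /=; apply/andP; split.
  apply/eqP; apply: eq_Rintegral => x _ /=.
  by rewrite oppr0 mul0r mulr0 cos0 sin0 mulr1 mulr0 subr0.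
apply/eqP; rewrite (@eq_Rintegral _ _ _ _ _ (fun=> 0)) ?Rintegral_cst ?mul0r// => x _ /=.
by rewrite oppr0 mul0r mulr0 cos0 sin0 mulr0 mul0r addr0.
Qed.

Lemma supported_closure f (T : R) : closure [set x | f x != 0] `<=` `[- T, T] ->
  supported T f.
Proof.
move=> cl x xT; apply/eqP/negPn/negP => fx.
have /cl : closure [set x | f x != 0] x by exact: subset_closure.
by rewrite /= in_itv /= -ler_norml leNgt xT.
Qed.

End SmoothWeights.

(** * The infinite sum as a windowed sum *)

Section WindowedSum.
Variables (R : realType) (d : nat).

Lemma esum_finType (J : finType) (f : J -> R) : (forall j, 0 <= f j) ->
  (\esum_(j in [set: J]) (f j)%:E = (\sum_j f j)%:E)%E.
Proof.
move=> f0; rewrite esum_fset; [|exact: finite_finset|by move=> j _; rewrite lee_fin].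
rewrite -sumEFin [RHS]fsbig_seq ?index_enum_uniq//.
by apply: eq_fsbigl; apply/seteqP; split => j //= _; rewrite mem_index_enum.
Qed.

(** The inverse of the embedding of windows: the coordinate [ord_max] is read off
the first component, and the others, lifted from ['I_d], off the second. *)
Definition window_row V K (j : 'I_(2 * V).+1 * {ffun 'I_d -> 'I_(2 * K).+1}) :
    'rV[int]_d.+1 :=
  \row_i (if unlift ord_max i is Some i' then cint (j.2 i') else cint j.1).

Lemma first_dE (i : 'I_d) : first_d i = lift ord_max i.
Proof. by apply: val_inj; rewrite /= /bump leqNgt ltn_ord. Qed.

Lemma window_row_max V K (j : 'I_(2 * V).+1 * {ffun 'I_d -> 'I_(2 * K).+1}) :
  window_row j 0 ord_max = cint j.1.
Proof. by rewrite mxE unlift_none. Qed.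

Lemma window_row_first V K (j : 'I_(2 * V).+1 * {ffun 'I_d -> 'I_(2 * K).+1}) i :
  window_row j 0 (first_d i) = cint (j.2 i).
Proof. by rewrite mxE first_dE liftK. Qed.

Lemma window_row_inj V K : injective (@window_row V K).
Proof.
move=> [k u] [k' u'] /rowP e; congr pair.
  by apply: cint_inj; have := e ord_max; rewrite !window_row_max.
apply/ffunP => i; apply: cint_inj.
by have := e (first_d i); rewrite !window_row_first.
Qed.

Lemma window_row_surj V K (a : 'rV[int]_d.+1) : `|a 0 ord_max| <= V%:Z ->
  (forall i, `|a 0 (first_d i)| <= K%:Z) -> exists j, @window_row V K j = a.
Proof.
move=> /cint_surj[k kE] aK.
have [u uE] := fin_all_exists (fun i => cint_surj (aK i)).
exists (k, [ffun i => u i]); apply/rowP => i.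
have [->|] := eqVneq i ord_max; first by rewrite window_row_max.
rewrite eq_sym => /unlift_some[i' -> _].
by rewrite -first_dE window_row_first /= ffunE uE.
Qed.

(** A point of nonzero weight has its last coordinate at most [T * N] in absolute
value, and then its other coordinates are bounded by the window [K]. *)
Lemma esum_weight (omega : 'I_d.+1 -> R -> R) (alpha gamma rho : 'rV[R]_d)
    (N V K : nat) (T : R) : (0 < N)%N ->
  (forall i x, 0 <= omega i x) -> (forall i, supported T (omega i)) ->
  (forall i, 0 < rho 0 i) -> T * N%:R <= V%:R ->
  (forall i, T * rho 0 i + (V%:R * `|alpha 0 i| + `|gamma 0 i|) + 1 <= K%:R) ->
  (\esum_(a in [set: 'rV[int]_d.+1]) (weight omega alpha (gamma, rho) N a)%:E =
   (count_sum alpha V K (fun i => omega (first_d i)) (omega ord_max)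
     (gamma 0) (rho 0) N%:R)%:E)%E.
Proof.
move=> N0 om0 omT rho0 TV TK; set w := weight omega alpha (gamma, rho) N.
have NR0 : 0 < N%:R :> R by rewrite ltr0n.
have w0 a : 0 <= w a by rewrite mulr_ge0//; apply: prodr_ge0 => i _.
have wsupp a : w a != 0 -> `|a 0 ord_max| <= V%:Z /\
    forall i, `|a 0 (first_d i)| <= K%:Z.
  rewrite mulf_eq0 negb_or => /andP[wk wi].
  have aV : `|(a 0 ord_max)%:~R| <= V%:R :> R.
    apply: le_trans TV; rewrite -ler_pdivrMr//.
    have -> : `|(a 0 ord_max)%:~R| / N%:R = `|(a 0 ord_max)%:~R / N%:R| :> R.
      by rewrite normrM normfV (gtr0_norm NR0).
    by rewrite leNgt; apply: contra wk => /omT ->.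
  split; first by rewrite -(ler_int R) intr_norm -pmulrn.
  move=> i; rewrite -(ler_int R) intr_norm -pmulrn.
  apply: le_trans (TK i).
  apply: (@le_trans _ _ (T * rho 0 i + (V%:R * `|alpha 0 i| + `|gamma 0 i|)));
    last by rewrite lerDl.
  move: wi; rewrite prodf_seq_neq0 => /allP/(_ i (mem_index_enum _)) /= wi.
  set x : R := (a 0 (first_d i))%:~R; set y := (a 0 ord_max)%:~R * alpha 0 i.
  have : `|x + y - gamma 0 i| <= T * rho 0 i.
    rewrite -ler_pdivrMr// -(gtr0_norm (rho0 i)) -normfV -normrM leNgt.
    by apply: contra wi => /omT ->.
  move=> h; have -> : x = (x + y - gamma 0 i) - y + gamma 0 i by ring.
  apply: (le_trans (ler_normD _ _)); rewrite addrA lerD2r.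
  apply: (le_trans (ler_normB _ _)).
  by rewrite lerD// /y normrM ler_wpM2r.
transitivity (\esum_(a in @window_row V K @` setT) (w a)%:E)%E.
  rewrite [RHS]esum_mkcond; apply: eq_esum => a _; case: ifPn => //.
  rewrite notin_setE => na; congr (_%:E); apply/eqP/negPn/negP => /wsupp[aV aK].
  by apply: na; have [j jE] := window_row_surj aV aK; exists j.
rewrite esum_image; last by move=> j j' _ _; exact: window_row_inj.
rewrite esum_finType; last by move=> j; exact: w0.
congr (_%:E); rewrite -(pair_bigA _ (fun k u => w (window_row (k, u)))) /=.
apply: eq_bigr => k _; rewrite /isum bigA_distr_bigA mulr_sumr.
apply: eq_bigr => u _; rewrite /w /weight window_row_max; congr (_ * _).
by apply: eq_bigr => i _; rewrite window_row_first addrA.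
Qed.

End WindowedSum.

(** * Small boxes and the discrepancy bound *)

Section SmallBoxes.
Variable R : realType.
Notation integral f := (Rintegral lebesgue_measure setT f).

(** Near a point where [f] is positive, [f] is bounded below; an affine change of
variable brings the support of [f] into that neighbourhood. *)
Lemma dilation_domination A (T : R) f : 0 < T -> smooth_bump A T f ->
  (forall x, 0 <= f x) -> 0 < integral f ->
  exists p : R * R * R, [/\ 0 < p.1.2, p.1.2 <= 1, 0 <= p.2 &
    forall y lam, 0 <= lam <= 1 -> f y <= p.2 * f (p.1.1 + p.1.2 * (lam * y))].
Proof.
move=> T0 [fT [B [fB [df dfB] _]]] f0 If.
have [x0 fx0] : exists x0, 0 < f x0.
  apply: contrapT => nf; move: If; suff -> : f = fun=> 0.
    by rewrite Rintegral_cst// mul0r ltxx.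
  apply/funext => x; apply/eqP; rewrite eq_le f0 andbT leNgt.
  by apply/negP => fx; apply: nf; exists x.
have fdf x : is_derive x (1 : R) f (derive1 f x).
  by rewrite derive1E; exact/derivableP.
have flip := derive_bound_lip fdf dfB.
have B0 : 0 <= B by exact: le_trans (normr_ge0 _) (fB 0).
have B1 : 0 < B + 1 by rewrite ltr_wpDl.
pose r := Num.min 1 (f x0 / 2 / (B + 1) / T).
have r0 : 0 < r by rewrite lt_min ltr01 !divr_gt0.
have rT : r * T <= f x0 / 2 / (B + 1) by rewrite -ler_pdivlMr// ge_min lexx orbT.
exists (x0, r, B / (f x0 / 2)); split=> //=.
- by rewrite ge_min lexx.
- by rewrite !divr_ge0// ltW.
move=> y lam /andP[l0 l1].
have [yT|yT] := leP `|y| T; last first.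
  by rewrite fT// mulr_ge0 ?divr_ge0// ltW.
have ly : `|r * (lam * y)| <= r * T.
  rewrite normrM (gtr0_norm r0) ler_wpM2l ?(ltW r0)// normrM (ger0_norm l0).
  by rewrite -[leRHS]mul1r ler_pM.
have : f x0 / 2 <= f (x0 + r * (lam * y)).
  have := flip x0 (x0 + r * (lam * y)).
  rewrite opprD addrA subrr sub0r normrN => fl.
  have : B * `|r * (lam * y)| <= f x0 / 2.
    apply: (@le_trans _ _ ((B + 1) * (r * T))).
      by apply: ler_pM => //; rewrite lerDl.
    by rewrite mulrC -ler_pdivlMr.
  by move: fl; rewrite ler_norml => /andP[_]; lra.
move=> fge; rewrite -mulrA; apply: (le_trans (le_trans (ler_norm _) (fB y))).
by rewrite ler_peMr// mulrC ler_pdivlMr ?divr_gt0// mul1r.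
Qed.

(** Raising the side lengths to a common power below 1 interpolates between the
box and the unit box. *)
Lemma enlarge_box (d : nat) (rho : 'I_d -> R) (H : R) : 1 <= H ->
  (forall i, 0 < rho i <= 1) -> \prod_i rho i < H^-1 ->
  exists rho' : 'I_d -> R, (forall i, rho i <= rho' i <= 1) /\ \prod_i rho' i = H^-1.
Proof.
move=> H1 rho01 rhoH.
have H0 : 0 < H by exact: lt_le_trans H1.
have rho0 i : 0 < rho i by have /andP[] := rho01 i.
have rhoE i : rho i = expR (ln (rho i)) by rewrite lnK// posrE.
have lr i : ln (rho i) <= 0 by apply: ln_le0; have /andP[] := rho01 i.
pose s := \sum_i ln (rho i).
have PE : \prod_i rho i = expR s by rewrite expR_sum; apply: eq_bigr.
have sH : s < - ln H.
  by rewrite -ltr_expR -PE expRN lnK// posrE.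
have lH : 0 <= ln H by exact: ln_ge0.
have s0 : s < 0 by apply: (lt_le_trans sH); rewrite oppr_le0.
pose th := - ln H / s.
have th0 : 0 <= th by rewrite /th mulNr -mulrN -invrN divr_ge0// oppr_ge0 ltW.
have th1 : th <= 1.
  rewrite /th mulNr -mulrN -invrN ler_pdivrMr ?oppr_gt0// mul1r.
  by rewrite lerNr ltW.
exists (fun i => expR (th * ln (rho i))); split.
  move=> i; apply/andP; split; last by rewrite -expR0 ler_expR mulr_ge0_le0.
  by rewrite [leLHS]rhoE ler_expR -[leLHS]mul1r ler_wnM2r.
by rewrite -expR_sum -mulr_sumr -/s /th divfK ?ltr0_neq0// expRN lnK// posrE.
Qed.

Lemma nat_bound (d : nat) (x : 'I_d -> R) : exists K : nat, forall i, x i <= K%:R.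
Proof.
exists (\max_i (Num.trunc `|x i|).+1)%N => i.
apply: (le_trans (ler_norm _)).
have /trunc_itv/andP[_ /ltW h] := normr_ge0 (x i); apply: (le_trans h).
by rewrite ler_nat; exact: (leq_bigmax (F := fun i => (Num.trunc `|x i|).+1)).
Qed.

Section BoxCount.
Variables (d : nat) (alpha : 'rV[R]_d) (phi : R -> R).
Hypothesis phi_ge1 : forall x : R, 1 <= x -> 1 <= phi x.
Hypothesis phi_nd : forall x y : R, 1 <= x -> x <= y -> phi x <= phi y.
Hypothesis halpha : forall m : 'rV[int]_d, m != 0 ->
  1 / (height (intv R m) * phi (height (intv R m)))
    < dist_int (dotv (intv R m) alpha).
Variables (D eta : R) (A : nat).
Hypotheses (D0 : 0 <= D) (eta0 : 0 < eta) (etaA : 2 * eta < 2 ^+ A).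
Hypothesis growth : forall n x, 1 <= x -> phi (2 ^+ n * x) <= D * eta ^+ n * phi x.
Hypothesis A3 : (3 <= A)%N.

(** Boxes of volume at least [1 / H0] fall under [count_sum_asymptotic].  A
smaller box sits inside one of volume about [1 / H0], whose count and volume are
both [O(phi H0)], as [N / H0 = phi H0]. *)
Lemma count_sum_uniform (T : R) (om : 'I_d -> R -> R) (omk : R -> R) :
  0 < T -> (forall i, smooth_bump A T (om i)) -> smooth_bump A T omk ->
  (forall i x, 0 <= om i x) -> (forall x, 0 <= omk x) ->
  (forall i, 0 < integral (om i)) ->
  exists2 C, 0 <= C & forall (N H0 : R) (gamma rho : 'I_d -> R),
    1 <= N -> 1 <= H0 -> H0 * phi H0 = N -> (forall i, 0 < rho i <= 1) ->
    exists V K : nat, [/\ T * N <= V%:R,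
     forall i, T * rho i + (V%:R * `|alpha 0 i| + `|gamma i|) + 1 <= K%:R &
    `|count_sum alpha V K om omk gamma rho N
      - (\prod_i (rho i * integral (om i))) * (N * integral omk)| <= C * phi H0].
Proof.
move=> T0 omb omkb om0 omk0 Iom.
have [p Hp] := fin_all_exists (fun i => dilation_domination T0 (omb i) (om0 i) (Iom i)).
pose x0 i := (p i).1.1; pose r i := (p i).1.2; pose kap i := (p i).2.
have r0 i : 0 < r i by have [] := Hp i.
have r1 i : r i <= 1 by have [] := Hp i.
have kap0 i : 0 <= kap i by have [] := Hp i.
have dom i y lam : 0 <= lam <= 1 ->
    om i y <= kap i * om i (x0 i + r i * (lam * y)).
  by have [_ _ _] := Hp i; apply.
have rV1 i : 1 <= (r i)^-1 by rewrite invf_ge1.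
pose T1 := 1 + \sum_i (r i)^-1.
have rT1 i : (r i)^-1 <= T1.
  rewrite /T1 (bigD1 i)//= addrCA lerDl addr_ge0//.
  by apply: sumr_ge0 => j _; rewrite invr_ge0 ltW.
have T11 : 1 <= T1 by rewrite lerDl; apply: sumr_ge0 => j _; rewrite invr_ge0 ltW.
have [Ca Ca0 HCa] := count_sum_asymptotic phi_ge1 phi_nd halpha D0 eta0 etaA growth
  A3 (ltW T0) T11 omb omkb.
have Ik0 : 0 <= integral omk by exact: Rintegral_ge0.
pose I1 := \prod_i integral (om i).
have I10 : 0 <= I1 by apply: prodr_ge0 => i _; exact: ltW.
pose I2 := \prod_i ((r i)^-1 * integral (om i)).
have I20 : 0 <= I2 by apply: prodr_ge0 => i _; rewrite mulr_ge0 ?invr_ge0 ?ltW.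
pose kappa := \prod_i kap i.
have kappa0 : 0 <= kappa by apply: prodr_ge0.
pose C2 := kappa * (I2 * integral omk + Ca) + I1 * integral omk.
have C20 : 0 <= C2 by rewrite addr_ge0 ?mulr_ge0 ?addr_ge0 ?mulr_ge0.
exists (Ca + C2) => [|N H0 gamma rho N1 H01 HN rho01]; first by rewrite addr_ge0.
have rho0 i : 0 < rho i by have /andP[] := rho01 i.
have N0 : 0 < N by exact: lt_le_trans N1.
have HH0 : 0 < H0 by exact: lt_le_trans H01.
have phi0 : 0 <= phi H0 by rewrite (le_trans _ (phi_ge1 H01)).
have [V TV] : exists V : nat, T * N <= V%:R.
  by exists (Num.trunc (T * N)).+1; have /trunc_itv/andP[_ /ltW] : 0 <= T * N
    by rewrite mulr_ge0// ltW.
exists V.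
have [rhoH|rhoH] := leP H0^-1 (\prod_i rho i).
  have [K TK] := nat_bound
    (fun i => T * rho i + (V%:R * `|alpha 0 i| + `|gamma i|) + 1).
  exists K; split=> //; apply: (@le_trans _ _ (Ca * phi H0)).
    apply: HCa => // i; rewrite rho0 /= (le_trans _ T11)//.
    by have /andP[] := rho01 i.
  by rewrite ler_wpM2r// lerDl.
have [rho' [rho'P rho'H]] := enlarge_box H01 rho01 rhoH.
pose rho2 i := (r i)^-1 * rho' i.
have rho'0 i : 0 < rho' i by have /andP[h _] := rho'P i; exact: lt_le_trans h.
(* The dilation [y |-> x0 + r * y] of the weights amounts to the sides
   [rho' / r] and to a translation of the centre. *)
pose gamma2 i := gamma i - x0 i * rho2 i.
have [K TK] := nat_bound (fun i =>
  Num.max (T * rho i + (V%:R * `|alpha 0 i| + `|gamma i|) + 1)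
          (T * rho2 i + (V%:R * `|alpha 0 i| + `|gamma2 i|) + 1)).
have TK1 i : T * rho i + (V%:R * `|alpha 0 i| + `|gamma i|) + 1 <= K%:R.
  by apply: le_trans (TK i); rewrite le_max lexx.
have TK2 i : T * rho2 i + (V%:R * `|alpha 0 i| + `|gamma2 i|) + 1 <= K%:R.
  by apply: le_trans (TK i); rewrite le_max lexx orbT.
exists K; split=> //.
have rho2T i : 0 < rho2 i <= T1.
  rewrite mulr_gt0 ?invr_gt0//= (le_trans _ (rT1 i))// ler_piMr ?invr_ge0 ?(ltW (r0 i))//.
  by have /andP[] := rho'P i.
have rho2H : H0^-1 <= \prod_i rho2 i.
  rewrite -rho'H; apply: ler_prod => i _; rewrite (ltW (rho'0 i)) /=.
  by rewrite ler_peMl// ltW.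
have asym := HCa N H0 gamma2 rho2 V K N1 H01 rho2T rho2H TV TK2.
set S2 := count_sum _ _ _ _ _ _ _ _ in asym.
set S := count_sum _ _ _ _ _ _ _ _.
have S0 : 0 <= S.
  apply: sumr_ge0 => k _; rewrite mulr_ge0//; apply: prodr_ge0 => i _.
  exact: sumr_ge0.
have SS2 : S <= kappa * S2.
  rewrite /S /S2 /count_sum /isum mulr_sumr; apply: ler_sum => k _.
  rewrite mulrCA ler_wpM2l// /kappa -big_split /=; apply: ler_prod => i _.
  rewrite sumr_ge0//= mulr_sumr; apply: ler_sum => b _.
  set z := _ + (_ - gamma i).
  have lam : 0 <= rho i / rho' i <= 1.
    rewrite divr_ge0 ?(ltW (rho0 i)) ?(ltW (rho'0 i))//= ler_pdivrMr// mul1r.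
    by have /andP[] := rho'P i.
  have := dom i (z / rho i) _ lam.
  have -> // : x0 i + r i * (rho i / rho' i * (z / rho i)) =
    ((cint b)%:~R + ((cint k)%:~R * alpha 0 i - gamma2 i)) / rho2 i.
  have a1 := r0 i; have a2 := rho0 i; have a3 := rho'0 i.
  by rewrite /gamma2 /z /rho2; field; rewrite !gt_eqF.
have NH : N / H0 = phi H0 by rewrite -HN mulrAC mulfV ?gt_eqF// mul1r.
have main2 : (\prod_i (rho2 i * integral (om i))) * (N * integral omk) =
    I2 * integral omk * phi H0.
  have -> : \prod_i (rho2 i * integral (om i)) = I2 * H0^-1.
    by rewrite -rho'H /I2 -big_split /=; apply: eq_bigr => i _; rewrite /rho2; ring.
  by rewrite -NH; ring.
have main1 : (\prod_i (rho i * integral (om i))) * (N * integral omk) <=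
    I1 * integral omk * phi H0.
  rewrite big_split /= -/I1 -NH.
  have -> : I1 * integral omk * (N / H0) = H0^-1 * I1 * (N * integral omk) by ring.
  rewrite ler_wpM2r ?mulr_ge0 ?(ltW N0)// ler_wpM2r//.
  exact: ltW.
have main0 : 0 <= (\prod_i (rho i * integral (om i))) * (N * integral omk).
  rewrite mulr_ge0 ?mulr_ge0 ?(ltW N0)//; apply: prodr_ge0 => i _.
  by rewrite mulr_ge0 ?ltW.
apply: (@le_trans _ _ (C2 * phi H0)); last by rewrite ler_wpM2r// lerDr.
apply: (le_trans (ler_normB _ _)); rewrite (ger0_norm S0) (ger0_norm main0).
rewrite /C2 mulrDl lerD// (le_trans SS2)// -mulrA ler_wpM2l// mulrDl -main2.
by rewrite -lerBlDl; apply: le_trans asym; exact: ler_norm.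
Qed.

End BoxCount.
End SmallBoxes.

Theorem theorem1p7 (R : realType) (d : nat) (hd : (1 <= d)%N)
    (alpha : 'rV[R]_d) (phi L : R -> R)
    (phi_ge1 : forall x : R, 1 <= x -> 1 <= phi x)
    (phi_nd : forall x y : R, 1 <= x -> x <= y -> phi x <= phi y)
    (hL : is_L phi L)
    (halpha : forall m : 'rV[int]_d, m != 0 ->
       1 / (height (intv R m) * phi (height (intv R m)))
         < dist_int (dotv (intv R m) alpha))
    (xi : R)
    (hxi : limf_esup (fun x : R => (phi (2 * x) / phi x)%:E) (pinfty_nbhs R)
           = xi%:E)
    (l : nat) (hl : 2 + 2 * (ln xi / ln 2) < l%:R)
    (omega : 'I_d.+1 -> R -> R) (homega : classG l omega) :
  exists C : R, forall N : nat, (0 < N)%N -> phi 1 <= N%:R ->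
    (discr omega alpha N <= (C * phi (L N%:R))%:E)%E.
Proof.
have [l3 [eta xieta etal]] := growth_rate phi_ge1 phi_nd hxi hl.
have [D D0 growth] := doubling_growth phi_ge1 phi_nd hxi xieta.
have eta0 : 0 < eta.
  apply: lt_trans xieta.
  by rewrite (lt_le_trans _ (limsup_doubling_ge1 phi_ge1 phi_nd hxi)).
have om0 i x : 0 <= omega i x by have [] := homega i.
have omT i : supported 2 (omega i).
  by have [_ _ cl _ _] := homega i; exact: supported_closure.
have omb i : smooth_bump l 2 (omega i).
  by have [_ cd _ _ _] := homega i; apply: contdiff_smooth_bump => //; exact: ltnW.
have omI i : 0 < Rintegral lebesgue_measure setT (omega i).
  by have [_ _ _ _] := homega i; rewrite fourier0 ltcR.
have [C C0 HC] := count_sum_uniform phi_ge1 phi_nd halpha D0 eta0 etal growth l3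
  (om := fun i => omega (first_d i)) (omk := omega ord_max) (ltr0Sn R 1)
  (fun i => omb _) (omb _) (fun i => om0 _) (om0 _) (fun i => omI _).
exists C => N N0 phiN.
have [/andP[L1 _] LE] := hL _ phiN.
have N1 : 1 <= N%:R :> R by rewrite ler1n.
apply: ge_ereal_sup => _ [[gamma rho] /= rhoB <-].
have rho0 i : 0 < rho 0 i by have /andP[] := rhoB i.
have rho1 i : 0 < rho 0 i <= 1.
  by rewrite rho0 /=; have /andP[_ /ltW] := rhoB i; rewrite /=; lra.
have [V [K [TV TK bound]]] := HC N%:R (L N%:R) (gamma 0) (rho 0) N1 L1 LE rho1.
rewrite /discrB (esum_weight N0 om0 omT rho0 TV TK).
rewrite -EFinB /= lee_fin.
have -> // : Cconst omega * vol (gamma, rho) N =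
  (\prod_i (rho 0 i * Rintegral lebesgue_measure setT (omega (first_d i)))) *
  (N%:R * Rintegral lebesgue_measure setT (omega ord_max)).
rewrite /Cconst /vol /=.
have -> : \prod_(i < d.+1) fourier (omega i) 0 =
  (\prod_(i < d.+1) Rintegral lebesgue_measure setT (omega i))%:C.
  by rewrite rmorph_prod; apply: eq_bigr => i _; rewrite fourier0.
by rewrite /= big_ord_recr /= big_split /=; ring.
Qed.
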